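(* Let $U_N$ be Haar distributed on the orthogonal group $\mathrm O(N)$. Let $\mathcal A_0^N=(A_i^N)_{i\in\mathcal I_0}$, $A_i^N\in\mathcal E^N_{\ell_0(i)}$, be a finite deterministic collection of tensors stable under entrywise complex conjugation (with $\mathcal I_0,\ell_0$ not depending on $N$) satisfying (A1): for every $\mathfrak n\in\mathcal M_0(\mathcal I_0)$, $\sup_N|\mathfrak n(\mathcal A_0^N)|<\infty$. Let $\mathcal I=\mathcal I_0\sqcup\{\mathbf u\}$, $\ell=\ell_0$ on $\mathcal I_0$, $\ell(\mathbf u)=2$, $A^N_{\mathbf u}=U_N$, $\mathcal A^N=(A_i^N)_{i\in\mathcal I}$ and $\mathbb E_N[\mathfrak n]=\mathbb E[\mathfrak n(\mathcal A^N)]$. Let $\mathfrak m=(\pi,\alpha,w)\in\mathcal M_0(\mathcal I)$ with $\gamma$ connected components, $\varepsilon\in\{1,2\}$, and $u\in V(\mathfrak m)$ with $w_u=\mathbf u$, $\partial u=(f_1,f_2)$. Then, as $N\to\infty$, $$\mathbb E_N[\mathfrak m]=\sum_v\mathbb E_N[\mathfrak m^+_{u,v,\varepsilon}]-\sum_v\mathbb E_N[\mathfrak m^-_{u,v,\varepsilon}]+O\Big(\frac1N\Big),$$ where the sums are over all $v\ne u$ in $V(\mathfrak m)$ in the connected component of $u$, $\partial v=(g_1,g_2)$, such that $w_v=\mathbf u$ and $\mathfrak m^{+}_{u,v,\varepsilon}$ (respectively $\mathfrak m^-_{u,v,\varepsilon}$) has $\gamma+1$ connected components (so that it is smaller than $\mathfrak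 m$ in the poset of maps). Here $\mathfrak m^+_{u,v,\varepsilon}$ is obtained from $\mathfrak m$ by the switch which connects $f_\varepsilon$ with $g_\varepsilon$ and $\alpha(f_\varepsilon)$ with $\alpha(g_\varepsilon)$, and $\mathfrak m^-_{u,v,\varepsilon}$ by the switch which connects $f_\varepsilon$ with $\alpha(g_\varepsilon)$ and $\alpha(f_\varepsilon)$ with $g_\varepsilon$. Finally, $\mathfrak m^+_{u,v,\varepsilon}(\mathcal A^N)$ is left unchanged if the matrices at $u$ and $v$ ($w_u=w_v=\mathbf u$) are replaced by the identity matrix.
   Context: Maps. $[n]=\{1,\dots,n\}$. A (combinatorial) map is a pair $\mathfrak m=(\pi,\alpha)$ of permutations of a set $\vec E(\mathfrak m)=[m]$ of half-edges, $\alpha$ an involution ($\alpha^2=\mathrm{id}$, fixed points allowed). The cycles of $\pi$ are the vertices, forming $V(\mathfrak m)$ and ordered by least element; $\partial v$ is the cycle of $v$ started at its least element (the half-edges attached to $v$), and $\deg(v)$ its length. Fixed points of $\alpha$ are the boundary edges; the 2-cycles of $\alpha$ are the edges. $E(\mathfrak m)$ is the set of all cycles of $\alpha$. $\mathcal M_q$ is the set of maps with $q$ boundary edges. An $I$-map (for an index set $I$ with order function $\ell$) is a map with labels $w_v\in I$, $\ell(w_v)=\deg(v)$, written $(\pi,\alpha,w)$; $\mathcal M_q(I)$ is the set of $I$-maps with $q$ boundary edges. Trace action. $\mathcal E^N_p=(\mathbb C^N)^{\otimes p}$. For $\mathfrak m\in\mathcal M_0(I)$ with $\gamma$ connected components and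 a family $\mathcal A^N=(A_i^N)_{i\in I}$, $A_i^N\in\mathcal E^N_{\ell(i)}$, $\mathfrak m(\mathcal A^N)=N^{-\gamma}\sum_{i\in[N]^{E(\mathfrak m)}}\prod_v(A^N_{w_v})_{i_{\partial v}}\in\mathbb C$, where $i_{\partial v}$ is the tuple of indices of the edges containing the half-edges of $\partial v$. Switches and poset. A switch replaces two edges $\{h_1,h_2\},\{h_3,h_4\}$ by $\{h_1,h_3\},\{h_2,h_4\}$ or $\{h_1,h_4\},\{h_2,h_3\}$; the new map is smaller than the old one if it has one more connected component. Convention in the degenerate case $\alpha(f_\varepsilon)=g_\varepsilon$ (the two edges to be switched coincide): $\mathfrak m^+_{u,v,\varepsilon}$ is $\mathfrak m$ together with one extra connected component consisting of a single degree-2 vertex carrying the identity matrix $I_N$ and a loop edge (value 1), and counts as having $\gamma+1$ components, while $\mathfrak m^-_{u,v,\varepsilon}$ is $\mathfrak m$ itself, with $\gamma$ components (hence does not appear in the sum). (Equivalently, an identity vertex is inserted in that edge before switching.) The constant in $O(1/N)$ may depend on $\mathfrak m$ but not on $N$. *)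

(* Defs.v *)
From HB Require Import structures.
From mathcomp Require Import all_boot all_order fingroup perm all_algebra.
From mathcomp Require Import all_classical all_reals all_analysis.
From mathcomp Require Import complex.
Set Implicit Arguments.
Unset Strict Implicit.
Unset Printing Implicit Defensive.
Import Order.TTheory GRing.Theory Num.Theory.
Import numFieldNormedType.Exports.

Local Open Scope ring_scope.

(* The type of the cycles of a permutation (fixed points included); a cycle is
   the set of its elements. *)
Definition pcycle n (s : 'S_n) := {c : {set 'I_n} | c \in porbits s}.

Definition pcycle_of n (s : 'S_n) (h : 'I_n) : pcycle s :=
  exist _ (porbit s h) (imset_f (porbit s) (isT : h \in 'I_n)).

Lemma pcycle_neq0 n (s : 'S_n) (c : pcycle s) : exists h, h \in val c.
Proof. by case: c => _ /= /imsetP[h _ ->]; exists h; apply: porbit_id. Qed.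

Definition pcycle_least n (s : 'S_n) (c : pcycle s) : 'I_n :=
  [arg min_(h < xchoose (pcycle_neq0 c) in val c) (h : nat)].

Definition pcycle_len n (s : 'S_n) (c : pcycle s) : nat := #|val c|.

Definition pcycle_list n (s : 'S_n) (c : pcycle s) :
    (pcycle_len c).-tuple 'I_n :=
  [tuple (s ^+ k)%g (pcycle_least c) | k < pcycle_len c].

Lemma pcycle_least_in n (s : 'S_n) (c : pcycle s) : pcycle_least c \in val c.
Proof.
by rewrite /pcycle_least; case: arg_minnP => //; apply: (xchooseP (pcycle_neq0 c)).
Qed.

Lemma pcycle_of_least n (s : 'S_n) (c : pcycle s) :
  pcycle_of s (pcycle_least c) = c.
Proof.
apply: val_inj; move: (pcycle_least_in c); case: c => A /= Aorb.
move: (pcycle_least _) => h; case/imsetP: Aorb => k _ -> hk.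
by apply/eqP; rewrite eq_porbit_mem.
Qed.

(* Half-edges are numbered from 0: 'I_nhalf stands for [nhalf]. Boundary edges
   are counted in edge m, which is the set of all cycles of eperm m. *)
Record cmap := CMap {
  nhalf : nat;
  vperm : 'S_nhalf;
  eperm : 'S_nhalf;
  epermK : involutive eperm }.

Notation vertex m := (pcycle (vperm m)).
Notation edge m := (pcycle (eperm m)).

Definition bdry (m : cmap) (v : vertex m) := pcycle_list v.
Definition deg (m : cmap) (v : vertex m) : nat := pcycle_len v.
Definition nboundary (m : cmap) : nat := #|[set h | eperm m h == h]|.

Definition madj (m : cmap) : rel 'I_(nhalf m) :=
  fun h k => (k \in porbit (vperm m) h) || (k \in porbit (eperm m) h).
Definition mconnect (m : cmap) : rel (vertex m) :=
  fun u v => connect (madj (m := m)) (pcycle_least u) (pcycle_least v).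
Definition ncomponents (m : cmap) : nat := n_comp (madj (m := m)) predT.

Record imap (I : Type) (l : I -> nat) := IMap {
  imap_map :> cmap;
  label : vertex imap_map -> I;
  label_deg : forall v, deg v = l (label v) }.

(* Tensors of order p are represented by their coordinates in the canonical
   basis of (C^N)^{(x) p}. *)
Definition tensor (R : realType) (N p : nat) :=
  {ffun p.-tuple 'I_N -> R[i]}.

Definition tfamily (R : realType) (N : nat) (I : Type) (l : I -> nat) :=
  forall i, tensor R N (l i).

(* Only meant for p = 2: the tensor with coordinates M a b; it is zero in any
   other order. *)
Definition mx_tensor (R : realType) (N p : nat) (M : 'M[R[i]]_N) :
    tensor R N p :=
  [ffun t => if tval t is [:: a; b] then M a b else 0].

Definition edge_indices (m : cmap) (N : nat) (i : {ffun edge m -> 'I_N})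
    (v : vertex m) : (deg v).-tuple 'I_N :=
  [tuple i (pcycle_of (eperm m) (tnth (bdry v) k)) | k < deg v].

Definition vertex_trace (R : realType) (m : cmap) (N : nat)
    (T : forall v : vertex m, tensor R N (deg v)) : R[i] :=
  N%:R ^- ncomponents m *
  \sum_(i : {ffun edge m -> 'I_N}) \prod_(v : vertex m) T v (edge_indices i v).

Definition label_tensor (R : realType) (I : Type) (l : I -> nat) (m : imap l)
    (N : nat) (A : tfamily R N l) (v : vertex m) : tensor R N (deg v) :=
  [ffun t => A (label v) (tcast (label_deg v) t)].

Definition trace (R : realType) (I : Type) (l : I -> nat) (m : imap l)
    (N : nat) (A : tfamily R N l) : R[i] :=
  vertex_trace (label_tensor (m := m) A).

(* Adjoining to I a label None of order 2, carried by a matrix. It is used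
   both for the label of U_N and for that of the identity matrix. *)
Definition adjl (I : Type) (l : I -> nat) (o : option I) : nat :=
  if o is Some i then l i else 2.

Definition adjoin (R : realType) (N : nat) (I : Type) (l : I -> nat)
    (A : tfamily R N l) (M : 'M[R[i]]_N) : tfamily R N (adjl l) :=
  fun o => match o return tensor R N (adjl l o) with
           | Some i => A i
           | None => mx_tensor 2 M
           end.

Definition some_label (I : Type) (l : I -> nat) (m : imap l) : imap (adjl l) :=
  @IMap (option I) (adjl l) m (fun v => Some (label v)) (@label_deg I l m).

(* Conjugating alpha by the transposition (alpha f  g) replaces the edges
   {f, alpha f} and {g, alpha g} by {f, g} and {alpha f, alpha g}. *)
Definition switch_perm n (a : 'S_n) (f g : 'I_n) : 'S_n := (a ^ tperm (a f) g)%g.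

Lemma switch_permK n (a : 'S_n) (f g : 'I_n) :
  involutive a -> involutive (switch_perm a f g).
Proof.
move=> aK; have aa : (a * a = 1)%g by apply/permP => x; rewrite permM aK perm1.
by move=> x; rewrite -permM -conjMg aa conj1g perm1.
Qed.

Lemma switch_permL n (a : 'S_n) (f g : 'I_n) :
  involutive a -> f != a f -> f != g -> switch_perm a f g f = g.
Proof.
move=> aK faf fg; rewrite /switch_perm conjgE !permM tpermV.
by rewrite (tpermD (z := f)) 1?[_ == f]eq_sym // tpermL.
Qed.

Lemma switch_permR n (a : 'S_n) (f g : 'I_n) :
  involutive a -> g != a g -> f != g -> switch_perm a f g (a f) = a g.
Proof.
move=> aK gag fg; rewrite /switch_perm conjgE !permM tpermV tpermL.
by rewrite tpermD // inj_eq //; apply: perm_inj.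
Qed.

Lemma switch_permD n (a : 'S_n) (f g h : 'I_n) :
  involutive a -> h \notin [:: f; a f; g; a g] -> switch_perm a f g h = a h.
Proof.
move=> aK; rewrite !inE !negb_or => /and4P[hf haf hg hag].
rewrite /switch_perm conjgE !permM tpermV.
rewrite (tpermD (z := h)) 1?eq_sym // tpermD //.
  by rewrite (inj_eq perm_inj) eq_sym.
by apply: contraNneq hag => ->; rewrite aK.
Qed.

Lemma switch_perm_id n (a : 'S_n) (f : 'I_n) :
  involutive a -> switch_perm a f f = a.
Proof.
move=> aK; rewrite /switch_perm; set t := tperm _ _.
have /conjg_fixP/commgP ta : (t ^ a = t)%g by rewrite tpermJ aK tpermC.
by apply/conjg_fixP/commgP; symmetry.
Qed.

Definition switch_cmap (m : cmap) (f g : 'I_(nhalf m)) : cmap :=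
  @CMap (nhalf m) (vperm m) (switch_perm (eperm m) f g)
    (switch_permK f g (@epermK m)).

Definition switch (I : Type) (l : I -> nat) (m : imap l)
    (f g : 'I_(nhalf m)) : imap l :=
  @IMap I l (switch_cmap f g) (@label I l m) (@label_deg I l m).

Definition sum_fun m n (s : 'S_m) (t : 'S_n) (h : 'I_(m + n)) : 'I_(m + n) :=
  match fintype.split h with inl a => lshift n (s a) | inr b => rshift m (t b) end.

Lemma sum_funl m n (s : 'S_m) (t : 'S_n) a :
  sum_fun s t (lshift n a) = lshift n (s a).
Proof. by rewrite /sum_fun (unsplitK (inl a)). Qed.

Lemma sum_funr m n (s : 'S_m) (t : 'S_n) b :
  sum_fun s t (rshift m b) = rshift m (t b).
Proof. by rewrite /sum_fun (unsplitK (inr b)). Qed.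

Lemma sum_fun_inj m n (s : 'S_m) (t : 'S_n) : injective (sum_fun s t).
Proof.
apply: (can_inj (g := sum_fun s^-1 t^-1)) => h.
by case: (split_ordP h) => a ->; rewrite !(sum_funl, sum_funr) permK.
Qed.

Definition sum_perm m n (s : 'S_m) (t : 'S_n) : 'S_(m + n) :=
  perm (sum_fun_inj (s := s) (t := t)).

Lemma sum_permK m n (s : 'S_m) (t : 'S_n) :
  involutive s -> involutive t -> involutive (sum_perm s t).
Proof.
move=> sK tK h; rewrite !permE.
by case: (split_ordP h) => a ->; rewrite !(sum_funl, sum_funr) (sK, tK).
Qed.

Lemma sum_permX m n (s : 'S_m) (t : 'S_n) k :
  (sum_perm s t ^+ k = sum_perm (s ^+ k) (t ^+ k))%g.
Proof.
apply/permP => h; elim: k h => [|k IH] h.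
  rewrite !expg0 perm1 permE.
  by case: (split_ordP h) => a ->; rewrite ?(sum_funl, sum_funr) perm1.
rewrite expgSr permM IH !permE.
by case: (split_ordP h) => a ->; rewrite !(sum_funl, sum_funr) expgSr permM.
Qed.

Lemma porbit_suml m n (s : 'S_m) (t : 'S_n) a :
  porbit (sum_perm s t) (lshift n a) = @lshift m n @: porbit s a.
Proof.
apply/setP => h; apply/porbitP/imsetP => [[k ->]|[b /porbitP[k ->] ->]].
  exists ((s ^+ k)%g a); first exact: mem_porbit.
  by rewrite sum_permX permE sum_funl.
by exists k; rewrite sum_permX permE sum_funl.
Qed.

Lemma porbit_sumr m n (s : 'S_m) (t : 'S_n) a :
  porbit (sum_perm s t) (rshift m a) = @rshift m n @: porbit t a.
Proof.
apply/setP => h; apply/porbitP/imsetP => [[k ->]|[b /porbitP[k ->] ->]].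
  exists ((t ^+ k)%g a); first exact: mem_porbit.
  by rewrite sum_permX permE sum_funr.
by exists k; rewrite sum_permX permE sum_funr.
Qed.

Definition union_cmap (m1 m2 : cmap) : cmap :=
  @CMap (nhalf m1 + nhalf m2) (sum_perm (vperm m1) (vperm m2))
    (sum_perm (eperm m1) (eperm m2))
    (sum_permK (@epermK m1) (@epermK m2)).

Definition union_label (I : Type) (l : I -> nat) (m1 m2 : imap l)
    (v : vertex (union_cmap m1 m2)) : I :=
  match fintype.split (pcycle_least v) with
  | inl h => label (pcycle_of (vperm m1) h)
  | inr h => label (pcycle_of (vperm m2) h)
  end.

Lemma union_label_deg (I : Type) (l : I -> nat) (m1 m2 : imap l)
    (v : vertex (union_cmap m1 m2)) :
  deg v = l (union_label v).
Proof.
rewrite /union_label -{1}(pcycle_of_least v); move: (pcycle_least v) => h.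
rewrite /deg /pcycle_len /=.
case: (split_ordP h) => a ->; rewrite -label_deg /deg /pcycle_len /=.
  by rewrite porbit_suml card_imset //; apply: lshift_inj.
by rewrite porbit_sumr card_imset //; apply: rshift_inj.
Qed.

Definition imap_union (I : Type) (l : I -> nat) (m1 m2 : imap l) : imap l :=
  IMap (@union_label_deg I l m1 m2).

Definition loop_cmap : cmap :=
  @CMap 2 (tperm ord0 ord_max) (tperm ord0 ord_max) (tpermK ord0 ord_max).

Lemma loop_deg (v : vertex loop_cmap) : deg v = 2.
Proof.
rewrite -[v]pcycle_of_least; move: (pcycle_least v) => h.
rewrite /deg /pcycle_len /= -[RHS](card_ord 2) -cardsT.
congr #|pred_of_set _|; apply/setP => k; rewrite inE.
have [->|kh] := eqVneq k h; first exact: porbit_id.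
suff -> : k = tperm ord0 ord_max h by exact: (mem_porbit _ 1 h).
apply: val_inj; move: kh; case: k => -[|[|//]] kp; case: h => -[|[|//]] hp /=;
  by rewrite permE.
Qed.

Definition identity_loop (I : Type) (l : I -> nat) : imap (adjl l) :=
  @IMap (option I) (adjl l) loop_cmap (fun=> None) loop_deg.

(* e : 'I_2 stands for e + 1 in {1, 2}; the default value of nth is never used
   when deg v = 2. *)
Definition half_edge (m : cmap) (v : vertex m) (e : 'I_2) : 'I_(nhalf m) :=
  nth (pcycle_least v) (bdry v) e.

(* When eperm m f = g the two edges coincide: a component made of a vertex
   carrying the identity matrix and a loop edge is then added, whence the extra
   label None in the type of map_plus; map_minus is then m itself, by
   switch_perm_id. *)
Definition map_plus (I : Type) (l : I -> nat) (m : imap l) (u v : vertex m)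
    (e : 'I_2) : imap (adjl l) :=
  let f := half_edge u e in
  let g := half_edge v e in
  if eperm m f == g then imap_union (some_label m) (identity_loop l)
  else some_label (switch f g).

Definition map_minus (I : Type) (l : I -> nat) (m : imap l) (u v : vertex m)
    (e : 'I_2) : imap l :=
  switch (half_edge u e) (eperm m (half_edge v e)).

(* The vertices of m remain vertices of map_plus m u v e, with the same
   half-edges numbered in the same way. *)
Definition same_vertex (m m' : cmap) (x : vertex m) (y : vertex m') : bool :=
  map (@nat_of_ord _) (bdry x) == map (@nat_of_ord _) (bdry y).

Definition orthogonal_mx (R : realType) (N : nat) : set 'M[R]_N :=
  [set O | O *m O^T = 1%:M]%classic.

(* U is a Borel random element of O(N) whose law is the Haar probability
   measure, i.e. is invariant under left translations. *)
Definition haar_orthogonal (R : realType) (d : measure_display)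
    (T : measurableType d) (P : probability T R) (N : nat)
    (U : T -> 'M[R]_N) : Prop :=
  let borel : set (set 'M[R]_N) := <<s open >>%classic in
  [/\ forall t, orthogonal_mx (U t),
      forall B, borel B -> measurable (U @^-1` B)%classic &
      forall O B, orthogonal_mx O -> borel B ->
        P ((fun t => O *m U t) @^-1` B)%classic = P (U @^-1` B)%classic].

Definition cexpectation (R : realType) (d : measure_display)
    (T : measurableType d) (P : probability T R) (X : T -> R[i]) : R[i] :=
  (fine ('E_P[fun t => complex.Re (X t)])%E +i*
   fine ('E_P[fun t => complex.Im (X t)])%E)%C.

Definition conj_stable (R : realType) (N : nat) (I : Type) (l : I -> nat)
    (A : tfamily R N l) : Prop :=
  forall i, exists j (e : l j = l i), forall t, A j t = ((A i (tcast e t))^*)%C.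

(* The label Some i stands for i, and None for that of U_N. *)
Definition with_orthogonal (R : realType) (N : nat) (I : Type) (l : I -> nat)
    (A : tfamily R N l) (U : 'M[R]_N) : tfamily R N (adjl l) :=
  adjoin A (map_mx (real_complex R) U).

Definition with_identity (R : realType) (N : nat) (I : Type) (l : I -> nat)
    (A : tfamily R N l) : tfamily R N (adjl l) :=
  adjoin A 1%:M.

(* Main.v *)
Require Import Defs.
From mathcomp Require Import all_boot all_order fingroup perm all_algebra.
From mathcomp Require Import all_classical all_reals all_analysis.
From mathcomp Require Import complex ring lra.
Set Implicit Arguments.
Unset Strict Implicit.
Unset Printing Implicit Defensive.
Import Order.TTheory GRing.Theory Num.Theory.
Import numFieldNormedType.Exports.
Local Open Scope ring_scope.

(* Left invariance of the law of U_N, tested on the rotations of a coordinate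
   plane (x, y) and expanded to first order in the angle, gives a linear relation
   between the moments of the entries of U_N. Cut the edge {f, alpha f} of the
   map into two half-edges with independent indices x and y, and sum the relation
   for the plane (x, y) against the remaining tensors: the term at u yields
   (N - 1) times the sum attached to the map, and each other vertex v carrying
   U_N yields the difference of the sums attached to the two switched maps.
   Dividing by N^(gamma + 1), the switched maps with gamma + 1 components give
   the main terms, the others are O(1/N) as soon as all the normalised means are
   bounded.
   Boundedness is proved by induction on the number of vertices carrying U_N.
   When f and g are joined, the orthogonality of U_N removes the two vertices, so
   only the negative switches remain in the relation; since a switch adds at most
   one component, they are absorbed by giving weight (k / N)^gamma, for a large
   constant k, to a map with gamma components. When no U_N remains, (A1)
   applies. A removed vertex is kept as a degree-2 vertex carrying the identity
   matrix and a loop, so that the set of half-edges does not change; it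
   contributes a factor N and a component. *)

(** * Colourings of the half-edges *)

(** A switch changes the edges, hence the index set of the sum defining a trace, but not the
    half-edges. Sums therefore run over colourings of half-edges restricted by [compat a], and every
    sum met in the argument is given by a permutation [a] and a set [K] of vertices still carrying
    [U_N], over one fixed type. Left invariance moves row indices only, whereas the chosen half-edge
    may carry a column index. The missing case comes from the invariance of the moments under
    transposition, itself deduced from left invariance. The obstacle to boundedness is that a
    negative switch removes no matrix and may add a component, so that an induction on the map alone
    never ends. All permutations with the same [K] have to be estimated together, at a fixed [N].
    The replacement by identity matrices holds for each outcome, before taking means: two joined
    vertices enter only through the sum over their common index, and this sum is the same for an
    orthogonal matrix and for the identity. *)

Definition upd (D : finType) (X : Type) (i : {ffun D -> X}) (h : D) (x : X) :
    {ffun D -> X} :=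
  [ffun k => if k == h then x else i k].

Section Update.
Variables (D X : finType).
Implicit Types (i : {ffun D -> X}) (h k : D) (x y : X).

Lemma updE i h x k : upd i h x k = if k == h then x else i k.
Proof. by rewrite ffunE. Qed.

Lemma upd_id i h : upd i h (i h) = i.
Proof. by apply/ffunP => k; rewrite updE; case: eqP => // ->. Qed.

Lemma upd_upd i h x y : upd (upd i h x) h y = upd i h y.
Proof. by apply/ffunP => k; rewrite !updE; case: eqP. Qed.

(** Exchanging the old colour of [h] with the new one is an involution on the pairs [(i, x)]. The
    multiplicity [#|X|] is carried along, here and later, instead of being divided out. *)
Lemma sum_upd (V : nmodType) (F : {ffun D -> X} -> V) h :
  \sum_i \sum_x F (upd i h x) = (\sum_i F i) *+ #|X|.
Proof.
rewrite pair_bigA /=.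
pose swap (p : {ffun D -> X} * X) := (upd p.1 h p.2, p.1 h).
have swapK : involutive swap.
  by case=> i x; rewrite /swap /= upd_upd upd_id updE eqxx.
rewrite (reindex_inj (inv_inj swapK)) /=.
under eq_bigr do rewrite upd_upd upd_id.
rewrite -(pair_bigA _ (fun i _ => F i)) /= -sumrMnl.
by apply: eq_bigr => i _; rewrite sumr_const.
Qed.

(** A fibrewise comparison: once the colour of [h] is summed, the two summands may read it in
    different places, which is what a switch does. *)
Lemma eq_sum_upd (C : numDomainType) (F G : {ffun D -> X} -> C) h :
  (0 < #|X|)%N ->
  (forall i, \sum_x F (upd i h x) = \sum_x G (upd i h x)) ->
  \sum_i F i = \sum_i G i.
Proof.
move=> X0 FG; apply: (pmulrnI X0); rewrite /= -!(sum_upd _ h).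
by apply: eq_bigr => i _; apply: FG.
Qed.

Lemma sum_delta_upd (C : numDomainType) (F : {ffun D -> X} -> C) h k :
  h != k -> (forall i x, F (upd i h x) = F i) ->
  (\sum_(i : {ffun D -> X}) (i h == i k)%:R * F i) *+ #|X| = \sum_i F i.
Proof.
move=> hk Fh; rewrite -(sum_upd _ h); apply: eq_bigr => i _.
rewrite (bigD1 (i k)) //= !updE eqxx [k == h]eq_sym (negPf hk) eqxx mul1r Fh.
rewrite big1 ?addr0 // => x xk.
by rewrite !updE eqxx [k == h]eq_sym (negPf hk) (negPf xk) mul0r.
Qed.

End Update.

Section Compatible.
Variables (n : nat) (X : finType).
Implicit Types (a b : 'S_n) (i : {ffun 'I_n -> X}) (s : seq 'I_n).

(* In compat_off, the constraint is dropped at the half-edges of s. *)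
Definition compat_off a s i := [forall h, (h \in s) || (i (a h) == i h)].
Definition compat a i := [forall h, i (a h) == i h].

Lemma compatE a i : compat a i = compat_off a [::] i.
Proof. by apply: eq_forallb => h. Qed.

Lemma compatP a i : reflect (forall h, i (a h) = i h) (compat a i).
Proof. by apply: (iffP forallP) => ai h; apply/eqP; rewrite ai. Qed.

(** The constraint along [{f, a f}] is tested at both ends, so it is already absent only when both
    ends lie in [s]; hence the disjunct. *)
Lemma compat_off_split a s i f : involutive a ->
  compat_off a s i =
    ((f \in s) && (a f \in s) || (i f == i (a f))) &&
    compat_off a [:: f, a f & s] i.
Proof.
move=> aK; apply/forallP/andP => [H|[H1 /forallP H2] h].
  split; last by apply/forallP => h; rewrite !inE; case/orP: (H h) => ->; rewrite !orbT.
  have := H f; have := H (a f); rewrite aK.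
  case: (f \in s); case: (a f \in s) => //=; rewrite ?orbF //.
  by rewrite eq_sym.
have := H2 h; rewrite !inE -!orbA.
case: (h =P f) => [-> _|_] /=.
  by case/orP: H1 => [/andP[->]//|]; rewrite eq_sym => ->; rewrite orbT.
case: (h =P a f) => [-> _|_] //=.
by case/orP: H1 => [/andP[_ ->]//|]; rewrite aK => ->; rewrite orbT.
Qed.

Lemma compat_off_upd a s i h x : involutive a ->
  (forall k, k \in s -> a k \in s) -> h \in s ->
  compat_off a s (upd i h x) = compat_off a s i.
Proof.
move=> aK sa hs; apply: eq_forallb => k; case: (boolP (k \in s)) => //= ks.
rewrite !updE !ifN //; apply: contraNneq ks => kh; first by rewrite kh.
by rewrite -(aK k) kh sa.
Qed.

Lemma eq_compat_off a b s i :
  (forall k, k \notin s -> a k = b k) -> compat_off a s i = compat_off b s i.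
Proof.
by move=> ab; apply: eq_forallb => h; case: (boolP (h \in s)) => //= /ab->.
Qed.

Lemma eq_mem_compat_off a s s' i :
  s =i s' -> compat_off a s i = compat_off a s' i.
Proof. by move=> ss'; apply: eq_forallb => h; rewrite ss'. Qed.

End Compatible.

Section Switches.
Variables (n : nat) (a : 'S_n).
Hypotheses (aK : involutive a) (a_fpf : forall h, a h != h).

Lemma eperm_neq h k : (a h == k) = (h == a k).
Proof. by rewrite -{2}[h]aK (inj_eq perm_inj). Qed.

Lemma switch_fpf f g h : switch_perm a f g h != h.
Proof.
rewrite /switch_perm conjgE !permM tpermV.
rewrite -[X in _ != X](tpermK (a f) g) (inj_eq perm_inj).
exact: a_fpf.
Qed.

Lemma compat_switch (X : finType) f g (i : {ffun 'I_n -> X}) :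
  f != g -> a f != g ->
  compat (switch_perm a f g) i =
    [&& i f == i g, i (a f) == i (a g) &
        compat_off a [:: f; a f; g; a g] i].
Proof.
move=> fg afg; have bK := switch_permK f g aK; set b := switch_perm a f g in bK *.
have bf : b f = g by apply: switch_permL; rewrite // eq_sym.
have baf : b (a f) = a g by apply: switch_permR; rewrite // eq_sym.
rewrite compatE (compat_off_split _ _ f bK) (compat_off_split _ _ (a f) bK) bf baf /=.
have ag : a f != a g by rewrite (inj_eq perm_inj).
rewrite !inE /= (negPf (a_fpf f)) (negPf afg) /=.
congr [&& _, _ & _].
rewrite (@eq_mem_compat_off _ _ _ _ [:: f; a f; g; a g]); last first.
  by move=> k; rewrite !inE; do ![case: (k == _) => //=].
apply: eq_compat_off => k kn; apply: switch_permD => //.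
Qed.

Lemma compat_four (X : finType) f g (i : {ffun 'I_n -> X}) :
  f != g -> a f != g ->
  compat a i =
    [&& i f == i (a f), i g == i (a g) &
        compat_off a [:: f; a f; g; a g] i].
Proof.
move=> fg afg.
rewrite compatE (compat_off_split _ _ f aK) (compat_off_split _ _ g aK) /=.
rewrite !inE /= [g == f]eq_sym (negPf fg) [g == a f]eq_sym (negPf afg) /=.
congr [&& _, _ & _]; apply: eq_mem_compat_off.
by move=> k; rewrite !inE; do ![case: (k == _) => //=].
Qed.

End Switches.

Lemma sum_delta (C : pzSemiRingType) (X : finType) (y : X) (F : X -> C) :
  \sum_x (x == y)%:R * F x = F y.
Proof.
rewrite (bigD1 y) //= eqxx mul1r big1 ?addr0 // => x /negPf->.
by rewrite mul0r.
Qed.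

(** * The Schwinger-Dyson identity and the contraction of two vertices *)

Section Network.
Variables (C : numFieldType) (n : nat) (V X : finType).
Variables (half : V -> 'I_2 -> 'I_n) (VU : {set V}).
Variables (W : {ffun 'I_n -> X} -> C) (mu : {set V} -> {ffun 'I_n -> X} -> C).

Implicit Types (i : {ffun 'I_n -> X}) (x y : X).

Hypothesis X_gt0 : (0 < #|X|)%N.
Hypothesis half_inj : forall v w e e', v \in VU -> w \in VU ->
  half v e = half w e' -> v = w /\ e = e'.
Hypothesis W_upd : forall v e i x, v \in VU -> W (upd i (half v e) x) = W i.
Hypothesis mu_upd : forall (K : {set V}) v e i x,
  K \subset VU -> v \in VU -> v \notin K -> mu K (upd i (half v e) x) = mu K i.
Hypothesis mu_SD : forall (K : {set V}) e i x y, K \subset VU ->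
  \sum_(v in K) ((i (half v e) == x)%:R * mu K (upd i (half v e) y)
                 - (i (half v e) == y)%:R * mu K (upd i (half v e) x)) = 0.
Hypothesis mu_orth : forall (K : {set V}) v w e i, K \subset VU ->
  v \in K -> w \in K -> v != w ->
  \sum_x mu K (upd (upd i (half v e) x) (half w e) x) =
    (i (half v (rev_ord e)) == i (half w (rev_ord e)))%:R *
    mu (K :\ v :\ w) i.

(** An unnormalised mean trace: [W] stands for the product of the deterministic tensors and [mu K]
    for the mean of the product of the entries of [U_N] at the vertices of [K]. Vertices of [VU]
    outside [K] carry no weight. *)
Definition netval (a : 'S_n) (K : {set V}) : C :=
  \sum_(i | compat a i) W i * mu K i.

Lemma netvalE a K : netval a K = \sum_i (compat a i)%:R * (W i * mu K i).
Proof.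
rewrite /netval big_mkcond; apply: eq_bigr => i _.
by case: ifP => _; rewrite (mul1r, mul0r).
Qed.

Section SchwingerDyson.
Variables (a : 'S_n) (K : {set V}) (u : V) (e : 'I_2).
Hypotheses (aK : involutive a) (a_fpf : forall h, a h != h).
Hypotheses (K_VU : K \subset VU) (uK : u \in K).
Let f := half u e.
Let off2 (i : {ffun 'I_n -> X}) : C := (compat_off a [:: f; a f] i)%:R.

Lemma compat_two i : (compat a i)%:R = (i f == i (a f))%:R * off2 i.
Proof. by rewrite compatE (compat_off_split _ _ f aK) -mulnb natrM. Qed.

Lemma off2_four g i : f != g -> a f != g ->
  off2 i = (i g == i (a g))%:R * (compat_off a [:: f; a f; g; a g] i)%:R.
Proof.
move=> fg afg; rewrite /off2 (compat_off_split _ _ g aK) !inE.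
rewrite [g == f]eq_sym (negPf fg) [g == a f]eq_sym (negPf afg) /= -mulnb natrM.
by congr (_ * _%:R); apply/congr1/eq_mem_compat_off => k; rewrite !inE;
  do ![case: (k == _) => //=].
Qed.

Lemma off2_upd i x : off2 (upd i f x) = off2 i.
Proof.
rewrite /off2 compat_off_upd //; last by rewrite !inE eqxx.
by move=> k; rewrite !inE => /orP[]/eqP->; rewrite ?aK eqxx ?orbT.
Qed.

Lemma off2_upd' i x : off2 (upd i (a f) x) = off2 i.
Proof.
rewrite /off2 compat_off_upd //; last by rewrite !inE eqxx orbT.
by move=> k; rewrite !inE => /orP[]/eqP->; rewrite ?aK eqxx ?orbT.
Qed.

Lemma off4_upd g i x :
  compat_off a [:: f; a f; g; a g] (upd i g x) =
  compat_off a [:: f; a f; g; a g] i.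
Proof.
rewrite compat_off_upd //; last by rewrite !inE eqxx !orbT.
by move=> k; rewrite !inE => /or4P[]/eqP->; rewrite ?aK eqxx ?orbT.
Qed.

(** The colour of [f] is overwritten and no other factor reads it, so it is free; the new colour
    [i (a f)] restores the edge. *)
Lemma SD_self :
  \sum_i off2 i * W i * mu K (upd i f (i (a f))) = netval a K *+ #|X|.
Proof.
have uVU := fintype.subsetP K_VU _ uK.
rewrite netvalE -(sum_upd _ f); apply: eq_bigr => i _.
rewrite -(sum_delta (i (a f)) (fun x => off2 i * W i * mu K (upd i f x))).
apply: eq_bigr => x _.
by rewrite compat_two off2_upd W_upd // !updE eqxx (negPf (a_fpf f)) !mulrA.
Qed.

(** With [g = half v e], the entry at [g] receives the colour of [a f], while the delta hands the
    colour of [f] over to [a g]: these are the two new edges. If [a f = g], the delta is the cut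
    edge itself, the update is void and the switch is trivial. *)
Lemma SD_minus v : v \in K -> v != u ->
  \sum_i off2 i * W i *
    ((i (half v e) == i f)%:R * mu K (upd i (half v e) (i (a f)))) =
  netval (switch_perm a f (a (half v e))) K.
Proof.
move=> vK vu; set g := half v e.
have vVU := fintype.subsetP K_VU _ vK; have uVU := fintype.subsetP K_VU _ uK.
have fg : f != g by apply/eqP => /(half_inj uVU vVU)[uv _]; rewrite uv eqxx in vu.
rewrite netvalE; have [afg|afg] := eqVneq (a f) g.
  rewrite -afg aK switch_perm_id //; apply: eq_bigr => i _.
  by rewrite upd_id compat_two [i (a f) == _]eq_sym; ring.
apply: (eq_sum_upd (h := g) X_gt0) => i.
have [[gf gaf] gag] := (negPf fg, negPf afg, negPf (a_fpf g)).
(* Both sums over the colour of [g] reduce to this single term: the delta selects [i f] on one side,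
   the new edge selects [i (a f)] on the other. *)
transitivity (\sum_x (x == i f)%:R *
  ((i f == i (a g))%:R * (compat_off a [:: f; a f; g; a g] i)%:R * W i *
     mu K (upd i g (i (a f))))).
  apply: eq_bigr => x _; rewrite (@off2_four g) // off4_upd !updE eqxx gf gaf gag.
  rewrite W_upd // upd_upd; by case: (x =P i f) => [->|_] /=; rewrite ?mulr1n ?mulr0n; ring.
rewrite sum_delta -(sum_delta (i (a f)) (fun x =>
  (i f == i (a g))%:R * (compat_off a [:: f; a f; g; a g] i)%:R * W i *
  mu K (upd i g x))).
apply: eq_bigr => x _; rewrite compat_switch //; last first.
- by rewrite (inj_eq perm_inj).
- by rewrite -(eperm_neq aK).
rewrite aK (@eq_mem_compat_off _ _ _ _ [:: f; a f; g; a g]); last first.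
  by move=> k; rewrite !inE; do ![case: (k == _) => //=].
rewrite off4_upd !updE eqxx gf gaf gag W_upd //.
by rewrite -!mulnb !natrM [i (a f) == _]eq_sym; ring.
Qed.

(** If [a f = half v e], the delta is always 1 and the overwritten colour is free. The resulting
    factor [#|X|] is the one that the identity loop stands for. *)
Lemma SD_plus v : v \in K -> v != u ->
  \sum_i off2 i * W i *
    ((i (half v e) == i (a f))%:R * mu K (upd i (half v e) (i f))) =
  if a f == half v e then netval a K *+ #|X|
  else netval (switch_perm a f (half v e)) K.
Proof.
move=> vK vu; set g := half v e.
have vVU := fintype.subsetP K_VU _ vK; have uVU := fintype.subsetP K_VU _ uK.
have fg : f != g by apply/eqP => /(half_inj uVU vVU)[uv _]; rewrite uv eqxx in vu.
case: eqVneq => [afg|afg].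
  rewrite netvalE -(sum_upd _ g); apply: eq_bigr => i _.
  rewrite -afg eqxx mul1r.
  rewrite -(sum_delta (i f) (fun x => off2 i * W i * mu K (upd i (a f) x))).
  apply: eq_bigr => x _.
  have Wa : W (upd i (a f) x) = W i by rewrite afg W_upd.
  rewrite compat_two off2_upd' Wa !updE eqxx.
  by rewrite eq_sym (eq_sym f) (negPf (a_fpf f)) !mulrA.
rewrite netvalE; apply: (eq_sum_upd (h := g) X_gt0) => i.
have [[gf gaf] gag] := (negPf fg, negPf afg, negPf (a_fpf g)).
transitivity (\sum_x (x == i (a f))%:R *
  ((i (a f) == i (a g))%:R * (compat_off a [:: f; a f; g; a g] i)%:R * W i *
     mu K (upd i g (i f)))).
  apply: eq_bigr => x _; rewrite (@off2_four g) // off4_upd !updE eqxx gf gaf gag.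
  rewrite W_upd // upd_upd; by case: (x =P i (a f)) => [->|_] /=; rewrite ?mulr1n ?mulr0n; ring.
rewrite sum_delta -(sum_delta (i f) (fun x =>
  (i (a f) == i (a g))%:R * (compat_off a [:: f; a f; g; a g] i)%:R * W i *
  mu K (upd i g x))).
apply: eq_bigr => x _; rewrite compat_switch //.
rewrite off4_upd !updE eqxx gf gaf gag W_upd //.
by rewrite -!mulnb !natrM [i f == _]eq_sym; ring.
Qed.

(** [mu_SD] is used with the colours [i f] and [i (a f)], which are independent once the edge is
    cut. In the second half of the term at [u], the delta closes the edge again; this is the copy of
    [netval a K] that is subtracted. *)
Lemma schwinger_dyson :
  netval a K *+ #|X| - netval a K =
  \sum_(v in K | v != u)
    ((if a f == half v e then netval a K *+ #|X|
      else netval (switch_perm a f (half v e)) K)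
     - netval (switch_perm a f (a (half v e))) K).
Proof.
have vVU := fintype.subsetP K_VU; apply/eqP; rewrite -subr_eq0; apply/eqP.
transitivity (\sum_i off2 i * W i * \sum_(v in K)
  ((i (half v e) == i f)%:R * mu K (upd i (half v e) (i (a f)))
   - (i (half v e) == i (a f))%:R * mu K (upd i (half v e) (i f)))); last first.
  by rewrite big1 // => i _; rewrite mu_SD ?mulr0.
under [RHS]eq_bigr do rewrite mulr_sumr.
rewrite exchange_big [in RHS](bigD1 u) //= -/f; congr (_ + _).
  rewrite -SD_self netvalE -sumrB; apply: eq_bigr => i _.
  by rewrite eqxx mul1r upd_id compat_two; ring.
rewrite -sumrN; apply: eq_bigr => v /andP[vK vu].
under eq_bigr do rewrite mulrBr.
by rewrite sumrB SD_minus // SD_plus // opprB.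
Qed.

End SchwingerDyson.
Section Contraction.
Variables (a : 'S_n) (K : {set V}) (v w : V) (e : 'I_2).
Hypotheses (aK : involutive a) (a_fpf : forall h, a h != h).
Hypotheses (K_VU : K \subset VU) (vK : v \in K) (wK : w \in K) (vw : v != w).
Let f := half v e.
Let f' := half v (rev_ord e).
Let g := half w e.
Let g' := half w (rev_ord e).
Hypothesis afg : a f = g.
Let K' := K :\ v :\ w.
Let c := switch_perm a f f'.

(* v and w become loops, and the half-edges formerly joined to f' and g' are
   joined to each other. *)
Definition contract_perm : 'S_n := switch_perm c g g'.

Let cK : involutive c := switch_permK f f' aK.
Let c_fpf h : c h != h. Proof. exact: switch_fpf. Qed.

Lemma contract_permK : involutive contract_perm.
Proof. exact: switch_permK. Qed.

Lemma contract_fpf h : contract_perm h != h.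
Proof. exact: switch_fpf. Qed.

Lemma rev_ord2_neq (k : 'I_2) : (rev_ord k == k) = false.
Proof. by case: k => -[|[|]]. Qed.

Lemma half_eq z z' k k' : z \in VU -> z' \in VU ->
  (half z k == half z' k') = (z == z') && (k == k').
Proof.
move=> zU z'U; apply/eqP/andP => [/(half_inj zU z'U)[-> ->]|[/eqP-> /eqP->]] //.
Qed.

Let vU : v \in VU. Proof. exact: fintype.subsetP vK. Qed.
Let wU : w \in VU. Proof. exact: fintype.subsetP wK. Qed.
Let ff' : (f == f') = false.
Proof. by rewrite half_eq // eqxx eq_sym rev_ord2_neq. Qed.
Let gg' : (g == g') = false.
Proof. by rewrite half_eq // eqxx eq_sym rev_ord2_neq. Qed.
Let fg : (f == g) = false. Proof. by rewrite half_eq // (negPf vw). Qed.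
Let fg' : (f == g') = false. Proof. by rewrite half_eq // (negPf vw). Qed.
Let f'g : (f' == g) = false. Proof. by rewrite half_eq // (negPf vw). Qed.
Let f'g' : (f' == g') = false. Proof. by rewrite half_eq // (negPf vw). Qed.
Let agf : a g = f. Proof. by rewrite -afg aK. Qed.
Let cf : c f = f'.
Proof. by apply: switch_permL; rewrite // ?ff' // eq_sym. Qed.
Let cg : c g = a f'.
Proof. by rewrite -afg; apply: switch_permR; rewrite // ?ff' // eq_sym. Qed.

Lemma contract_loop_l k : contract_perm (half v k) = half v (rev_ord k).
Proof.
have cf' : c f' = f by rewrite -cf cK.
have cne h : h \in [:: f; f'] -> h \notin [:: g; c g; g'; c g'].
  rewrite !inE => /orP[]/eqP->; rewrite -!(eperm_neq cK) ?cf ?cf'.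
    by rewrite fg f'g fg' f'g'.
  by rewrite fg f'g fg' f'g'.
have [->|ke] := eqVneq k e.
  by rewrite [LHS]switch_permD ?cf // cne // !inE eqxx.
have -> : k = rev_ord e by apply/val_inj; move: ke; case: k e => -[|[|]] // ? [[|[|]]].
by rewrite rev_ordK [LHS]switch_permD ?cf' // cne // !inE eqxx orbT.
Qed.

Lemma contract_loop_r k : contract_perm (half w k) = half w (rev_ord k).
Proof.
have bg : contract_perm g = g'.
  by apply: switch_permL; rewrite // ?gg' // eq_sym.
have [->//|ke] := eqVneq k e.
have -> : k = rev_ord e by apply/val_inj; move: ke; case: k e => -[|[|]] // ? [[|[|]]].
by rewrite rev_ordK -[RHS]contract_permK bg.
Qed.

Lemma contract_permD z k : z \in VU -> z \notin K ->
  (forall k, a (half z k) = half z (rev_ord k)) ->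
  contract_perm (half z k) = half z (rev_ord k).
Proof.
move=> zU zK az.
have zv : (z == v) = false by apply: contraNF zK => /eqP->.
have zw : (z == w) = false by apply: contraNF zK => /eqP->.
have cz k' : c (half z k') = half z (rev_ord k').
  rewrite [LHS]switch_permD // !inE -!(eperm_neq aK) az.
  by rewrite !half_eq // zv.
by rewrite [LHS]switch_permD // !inE -!(eperm_neq cK) cz !half_eq // zw.
Qed.

(** Resampling the colours of [f] and [g] accounts for the two multiples; the delta identifies the
    new colours and [mu_orth] sums over their common value. *)
Lemma sum_orth (Q : {ffun 'I_n -> X} -> C) :
  (forall i x, Q (upd i f x) = Q i) -> (forall i x, Q (upd i g x) = Q i) ->
  (\sum_(i : {ffun 'I_n -> X}) (i f == i g)%:R * (Q i * mu K i)) *+ #|X| *+ #|X| =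
  \sum_(i : {ffun 'I_n -> X}) (i f' == i g')%:R * (Q i * mu K' i).
Proof.
move=> Qf Qg; rewrite -(sum_upd _ g) -(sum_upd _ f); apply: eq_bigr => i _.
rewrite [RHS]mulrCA -(@mu_orth K v w e) // mulr_sumr; apply: eq_bigr => x _.
rewrite -(sum_delta x (fun y => Q i * mu K (upd (upd i f x) g y))).
apply: eq_bigr => y _; by rewrite !updE fg !eqxx Qg Qf eq_sym.
Qed.

Let K'_VU : K' \subset VU.
Proof.
by apply: fintype.subset_trans K_VU; do ![apply: fintype.subset_trans (finset.subsetDl _ _) _].
Qed.

Let rest_upd z k i x : (z \in VU) -> z \notin K' ->
  W (upd i (half z k) x) * mu K' (upd i (half z k) x) = W i * mu K' i.
Proof. by move=> zU zK; rewrite W_upd // mu_upd. Qed.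

Let vK' : v \notin K'. Proof. by rewrite !inE eqxx andbF. Qed.
Let wK' : w \notin K'. Proof. by rewrite !inE eqxx. Qed.

(** Here [v] and [w] close up into a component whose value is the trace of an identity matrix, that
    is [#|X|]. Two loops of value [#|X|] each replace it, whence one more factor. *)
Lemma netval_contract_loop : a f' = g' ->
  netval contract_perm K' = netval a K *+ #|X|.
Proof.
move=> af'; have bc : contract_perm = c.
  by rewrite /contract_perm /switch_perm cg af' tperm1 conjg1.
have nff' : f != f' by rewrite ff'.
have naff' : a f != f' by rewrite afg eq_sym f'g.
pose off i := compat_off a [:: f; g; f'; g'] i.
have stab k : k \in [:: f; g; f'; g'] -> a k \in [:: f; g; f'; g'].
  by rewrite -afg -af' !inE => /or4P[]/eqP->; rewrite ?aK eqxx ?orbT.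
have offu h i x : h \in [:: f; g; f'; g'] -> off (upd i h x) = off i.
  by move=> hs; apply: compat_off_upd.
have [of_ og of' og'] : [/\ f \in [:: f; g; f'; g'], g \in [:: f; g; f'; g'],
  f' \in [:: f; g; f'; g'] & g' \in [:: f; g; f'; g']].
  by rewrite !inE !eqxx !orbT.
have g'f' : (g' == f') = false by rewrite eq_sym.
have g'f : (g' == f) = false by rewrite eq_sym.
have gf' : (g == f') = false by rewrite eq_sym.
have gf : (g == f) = false by rewrite eq_sym.
have f'f : (f' == f) = false by rewrite eq_sym.
have g'g : (g' == g) = false by rewrite eq_sym.
have Ea : netval a K *+ #|X| *+ #|X| *+ #|X| =
    \sum_i (off i)%:R * (W i * mu K' i).
  rewrite netvalE.
  have -> : \sum_i (compat a i)%:R * (W i * mu K i) =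
      \sum_(i : {ffun 'I_n -> X}) (i f == i g)%:R *
        ((i f' == i g')%:R * (off i)%:R * W i * mu K i).
    apply: eq_bigr => i _; rewrite (compat_four aK i nff' naff') afg af'.
    by rewrite -!mulnb !natrM !mulrA.
  rewrite sum_orth; first last.
  - by move=> i x; rewrite offu // W_upd // !updE f'g g'g.
  - by move=> i x; rewrite offu // W_upd // !updE f'f g'f.
  rewrite -[RHS](@sum_delta_upd _ _ _ _ f' g') ?f'g' //; last first.
    by move=> i x; rewrite offu // rest_upd.
  congr (_ *+ _); apply: eq_bigr => i _.
  by case: (i f' == i g'); rewrite ?mul0r // !mul1r !mulrA.
have Eb : netval c K' *+ #|X| *+ #|X| = \sum_i (off i)%:R * (W i * mu K' i).
  rewrite netvalE.
  have -> : \sum_i (compat c i)%:R * (W i * mu K' i) =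
      \sum_(i : {ffun 'I_n -> X}) (i f == i f')%:R *
        ((i g == i g')%:R * ((off i)%:R * (W i * mu K' i))).
    apply: eq_bigr => i _; rewrite (compat_switch aK a_fpf i nff' naff') afg af'.
    by rewrite -!mulnb !natrM !mulrA.
  rewrite sum_delta_upd; [|by []|]; last first.
    by move=> i x; rewrite offu // rest_upd // !updE gf g'f.
  rewrite sum_delta_upd ?gg' // => i x; by rewrite offu // rest_upd.
by rewrite bc; apply: (pmulrnI X_gt0); apply: (pmulrnI X_gt0); rewrite /= Eb -Ea.
Qed.

(** The product of the two matrices is an identity, so the path through [v] and [w] shrinks to one
    edge; the two loops left behind account for both factors. *)
Lemma netval_contract_edge : a f' != g' ->
  netval contract_perm K' = netval a K *+ #|X| *+ #|X|.
Proof.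
move=> af'; set p := a f'; set q := a g'.
have nff' : f != f' by rewrite ff'.
have naff' : a f != f' by rewrite afg eq_sym f'g.
pose s := [:: f; g; f'; p; g'; q].
pose off i := compat_off a s i.
have stab k : k \in s -> a k \in s.
  by rewrite /s !inE => /or4P[|||/or3P[]]/eqP->;
     rewrite ?aK ?afg ?agf eqxx ?orbT.
have offu h i x : h \in s -> off (upd i h x) = off i.
  by move=> hs; apply: compat_off_upd.
have g'f' : (g' == f') = false by rewrite eq_sym.
have g'f : (g' == f) = false by rewrite eq_sym.
have gf' : (g == f') = false by rewrite eq_sym.
have gf : (g == f) = false by rewrite eq_sym.
have f'f : (f' == f) = false by rewrite eq_sym.
have g'g : (g' == g) = false by rewrite eq_sym.
have pf : (p == f) = false by rewrite eperm_neq // afg.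
have pg : (p == g) = false by rewrite eperm_neq // agf.
have pf' : (p == f') = false := negPf (a_fpf f').
have pg' : (p == g') = false := negPf af'.
have qf : (q == f) = false by rewrite eperm_neq // afg.
have qg : (q == g) = false by rewrite eperm_neq // agf.
have qf' : (q == f') = false by rewrite eperm_neq // eq_sym.
have qg' : (q == g') = false := negPf (a_fpf g').
have qp : (q == p) = false by rewrite /q /p (inj_eq perm_inj).
have cg' : c g' = q.
  by rewrite [LHS]switch_permD // !inE afg g'f g'g g'f' [g' == _]eq_sym pg'.
pose U := \sum_(i : {ffun 'I_n -> X}) (i p == i q)%:R *
  ((off i)%:R * (W i * mu K' i)).
have [of_ og of' og'] : [/\ f \in s, g \in s, f' \in s & g' \in s].
  by rewrite /s !inE !eqxx !orbT.
have Ea : netval a K *+ #|X| *+ #|X| *+ #|X| *+ #|X| = U.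
  rewrite netvalE.
  have -> : \sum_i (compat a i)%:R * (W i * mu K i) =
      \sum_(i : {ffun 'I_n -> X}) (i f == i g)%:R *
        ((i f' == i p)%:R * (i g' == i q)%:R * (off i)%:R * W i * mu K i).
    apply: eq_bigr => i _.
    rewrite (compat_four aK i nff' naff') (compat_off_split _ _ g' aK) afg -/p -/q.
    rewrite !inE g'f g'g g'f' [g' == p]eq_sym pg' /=.
    rewrite (@eq_mem_compat_off _ _ _ _ s); last first.
      by move=> k; rewrite /s !inE; do ![case: (k == _) => //=].
    by rewrite -!mulnb !natrM !mulrA.
  rewrite sum_orth; first last.
  - by move=> i x; rewrite offu // W_upd // !updE f'g g'g pg qg.
  - by move=> i x; rewrite offu // W_upd // !updE f'f g'f pf qf.
  rewrite -[RHS](@sum_delta_upd _ _ _ _ g' p) 1?eq_sym ?pg' //; last first.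
    by move=> i x; rewrite offu // rest_upd // !updE pg' qg'.
  congr (_ *+ _); rewrite -[RHS](@sum_delta_upd _ _ _ _ f' g') ?f'g' //; last first.
    by move=> i x; rewrite offu // rest_upd // !updE g'f' pf' qf'.
  congr (_ *+ _); apply: eq_bigr => i _.
  case: eqP => [->|]; rewrite ?mul0r // !mul1r.
  case: eqP => [->|]; rewrite ?mul0r // !mul1r !mulrA //.
have Eb : netval contract_perm K' *+ #|X| *+ #|X| = U.
  rewrite netvalE.
  have -> : \sum_i (compat contract_perm i)%:R * (W i * mu K' i) =
      \sum_(i : {ffun 'I_n -> X}) (i f == i f')%:R * ((i g == i g')%:R *
        ((i p == i q)%:R * ((off i)%:R * (W i * mu K' i)))).
    apply: eq_bigr => i _.
    rewrite (compat_switch cK c_fpf) ?gg' // cg -/p ?pg' // cg'.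
    rewrite (compat_off_split _ _ f cK) cf !inE.
    rewrite fg ![f == _]eq_sym pf g'f qf /=.
    rewrite (@eq_mem_compat_off _ _ _ _ s); last first.
      by move=> k; rewrite /s !inE; do ![case: (k == _) => //=].
    rewrite (@eq_compat_off _ _ c a).
      by rewrite -!mulnb !natrM; ring.
    move=> k ks; apply: switch_permD => //; apply: contra ks.
    by rewrite afg -/p /s !inE => /or4P[]->; rewrite ?orbT.
  rewrite sum_delta_upd; [|by []|]; last first.
    by move=> i x; rewrite offu // rest_upd // !updE gf g'f pf qf.
  rewrite sum_delta_upd ?gg' // => i x.
  by rewrite offu // rest_upd // !updE pg qg.
by do 2![apply: (pmulrnI X_gt0)]; rewrite /= Eb -Ea.
Qed.

End Contraction.
End Network.

(** * Boundedness of the normalised means *)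

Local Notation normc := ComplexField.Normc.normc.

Section FiniteUniform.
Variables (R : realType) (T : finType) (Q : pred T) (f g : T -> nat -> R).

(** The sums of the individual constants, in absolute value, and of the individual ranks serve all
    indices at once; this is where the nonnegativity of [g] enters. *)
Lemma uniform_bound :
  (forall x N, 0 <= g x N) ->
  (forall x, Q x -> exists B N0, forall N, (N0 <= N)%N -> f x N <= B * g x N) ->
  exists2 B, 0 <= B &
    exists N0, forall x N, Q x -> (N0 <= N)%N -> f x N <= B * g x N.
Proof.
move=> g0 H.
have H' x : exists p : R * nat,
    Q x -> forall N, (p.2 <= N)%N -> f x N <= p.1 * g x N.
  case: (boolP (Q x)) => [/H[B [N0 BN]]|_]; first by exists (B, N0).
  by exists (0, 0%N).
case/fin_all_exists: H' => p pP.
exists (\sum_x `|(p x).1|); first exact: sumr_ge0.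
exists (\sum_x (p x).2)%N => x N Qx; rewrite (bigD1 x) //= => leN.
apply: le_trans (pP x Qx N _) _; first exact: leq_trans (leq_addr _ _) leN.
apply: ler_wpM2r; rewrite // (bigD1 x) //=.
by apply: le_trans (ler_norm _) _; rewrite lerDl sumr_ge0.
Qed.

End FiniteUniform.

Section Bound.
Variables (R : realType) (n : nat) (V : finType).
Variables (half : V -> 'I_2 -> 'I_n) (VU : {set V}).
Implicit Types (K : {set V}) (a b : 'S_n).
Variable W : forall N, {ffun 'I_n -> 'I_N} -> R[i].
Variable mu : forall N, {set V} -> {ffun 'I_n -> 'I_N} -> R[i].
Variable gam : 'S_n -> nat.

Hypothesis half_inj : forall v w e e', v \in VU -> w \in VU ->
  half v e = half w e' -> v = w /\ e = e'.
Hypothesis W_upd : forall N v e (i : {ffun 'I_n -> 'I_N}) x,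
  v \in VU -> W (upd i (half v e) x) = W i.
Hypothesis mu_upd : forall N K v e (i : {ffun 'I_n -> 'I_N}) x,
  K \subset VU -> v \in VU -> v \notin K -> mu K (upd i (half v e) x) = mu K i.
Hypothesis mu_SD : forall N K e (i : {ffun 'I_n -> 'I_N}) (x y : 'I_N),
  (0 < N)%N -> K \subset VU ->
  \sum_(v in K) ((i (half v e) == x)%:R * mu K (upd i (half v e) y)
                 - (i (half v e) == y)%:R * mu K (upd i (half v e) x)) = 0.
Hypothesis mu_orth : forall N K v w e (i : {ffun 'I_n -> 'I_N}),
  (0 < N)%N -> K \subset VU -> v \in K -> w \in K -> v != w ->
  \sum_x mu K (upd (upd i (half v e) x) (half w e) x) =
    (i (half v (rev_ord e)) == i (half w (rev_ord e)))%:R *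
    mu (K :\ v :\ w) i.
Hypothesis gam_le : forall a, (gam a <= n)%N.
Hypothesis gam_switch : forall a f g, involutive a -> (forall h, a h != h) ->
  (gam (switch_perm a f g) <= (gam a).+1)%N.

Let val N := netval (@W N) (@mu N).

(** The invariant of the induction: each removed vertex is a loop, thus worth one factor [N] and one
    component. It is boolean because a maximum over the permutations satisfying it is taken
    below. *)
Definition good_perm K (a : 'S_n) :=
  [&& [forall h, a (a h) == h], [forall h, a h != h] &
   [forall v, (v \in VU) && (v \notin K) ==>
     [forall k, a (half v k) == half v (rev_ord k)]]].

Lemma good_permP K a : reflect
  [/\ involutive a, (forall h, a h != h) &
   forall v, v \in VU -> v \notin K -> forall k, a (half v k) = half v (rev_ord k)]
  (good_perm K a).
Proof.
apply: (iffP and3P) => [[/forallP aK /forallP af /forallP ad]|[aK af ad]].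
  split=> [h||v vU vK k]; [exact/eqP/aK|by []|].
  by move/(_ v): ad; rewrite vU vK => /forallP/(_ k)/eqP.
split; apply/forallP; [by move=> h; rewrite aK|by []|move=> v].
by apply/implyP => /andP[vU vK]; apply/forallP => k; rewrite ad.
Qed.

Hypothesis base : forall a, good_perm finset.set0 a ->
  exists B : R, forall N, (0 < N)%N ->
    normc (val N a finset.set0) <= B * N%:R ^+ gam a.

Lemma good_switch K a u x e : K \subset VU -> u \in K ->
  good_perm K a ->
  (forall z k, z \in VU -> z \notin K -> (half z k != x) && (half z k != a x)) ->
  good_perm K (switch_perm a (half u e) x).
Proof.
move=> KU uK /good_permP[aK af ad] xP; have uU := fintype.subsetP KU _ uK.
apply/good_permP; split; [exact: switch_permK | exact: switch_fpf|].
move=> z zU zK k; rewrite switch_permD ?(ad z) //.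
have zu : (z == u) = false by apply: contraNF zK => /eqP->.
have /andP[xz axz] := xP z k zU zK.
rewrite !inE -[_ == a (half u e)](eperm_neq aK) (ad z) // (negPf xz) (negPf axz) !orbF.
by rewrite !(half_eq half_inj) // zu.
Qed.

Lemma good_plus K a u v e : K \subset VU -> u \in K -> v \in K ->
  good_perm K a -> good_perm K (switch_perm a (half u e) (half v e)).
Proof.
move=> KU uK vK ga; apply: good_switch => // z k zU zK.
have [aK af ad] := good_permP _ _ ga; have vU := fintype.subsetP KU _ vK.
have zv : (z == v) = false by apply: contraNF zK => /eqP->.
by rewrite -(eperm_neq aK) (ad z) // !(half_eq half_inj) // zv.
Qed.

Lemma good_minus K a u v e : K \subset VU -> u \in K -> v \in K ->
  good_perm K a -> good_perm K (switch_perm a (half u e) (a (half v e))).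
Proof.
move=> KU uK vK ga; apply: good_switch => // z k zU zK.
have [aK af ad] := good_permP _ _ ga; have vU := fintype.subsetP KU _ vK.
have zv : (z == v) = false by apply: contraNF zK => /eqP->.
by rewrite -(eperm_neq aK) aK (ad z) // !(half_eq half_inj) // zv.
Qed.

Definition bounded_at K (a : 'S_n) :=
  exists (B : R) N0, forall N, (N0 <= N)%N ->
    normc (val N a K) <= B * N%:R ^+ gam a.

Lemma normc_ge0 (x : R[i]) : 0 <= normc x.
Proof. by case: x => a b; apply: sqrtr_ge0. Qed.

Lemma normcMn_nat (x : R[i]) N : normc (x *+ N) = normc x * N%:R.
Proof. by rewrite mulr_natr; apply: normcMn. Qed.

(** A contraction is made of two switches, so it adds at most two components, against a factor
    [N ^ 2]. When the factor is only [N], the first switch already joins the half-edges of [v], the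
    second one is trivial, and at most one component is added. *)
Lemma bounded_contract K a u v e : K \subset VU ->
  u \in K -> v \in K -> u != v -> good_perm K a -> a (half u e) = half v e ->
  (forall b, good_perm (K :\ u :\ v) b -> bounded_at (K :\ u :\ v) b) ->
  bounded_at K a.
Proof.
move=> KU uK vK uv ga auv IH; have [aK af ad] := good_permP _ _ ga.
have uU := fintype.subsetP KU _ uK; have vU := fintype.subsetP KU _ vK.
pose b := contract_perm half a u v e.
have gb : good_perm (K :\ u :\ v) b.
  apply/good_permP; split; [exact: contract_permK|exact: contract_fpf|].
  move=> z zU; rewrite !inE !negb_and !negbK.
  case: (z =P v) => [-> _ k|_ /=]; first exact: (contract_loop_r half_inj (K := K)).
  case: (z =P u) => [-> _ k|_ /= zK k]; first exact: (contract_loop_l half_inj (K := K)).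
  by apply: (contract_permD half_inj (K := K)) => // k'; apply: ad.
have [B [N0 HB]] := IH b gb; exists `|B|, N0.+1 => N leN.
have N0lt : (0 < N)%N by apply: leq_ltn_trans leN.
have card_gt0 : (0 < #|'I_N|)%N by rewrite card_ord.
have Npos : 0 < N%:R :> R by rewrite ltr0n.
have N1 : 1 <= N%:R :> R by rewrite ler1n.
have {HB} HB : normc (val N b (K :\ u :\ v)) <= `|B| * N%:R ^+ gam b.
  apply: le_trans (HB N (ltnW leN)) _.
  by apply: ler_wpM2r (ler_norm B); rewrite exprn_ge0 // ltW.
have mo := fun K v w e i => @mu_orth N K v w e i N0lt.
set c := switch_perm a (half u e) (half u (rev_ord e)).
have gc : (gam c <= (gam a).+1)%N by apply: gam_switch.
have gbc : (gam b <= (gam c).+1)%N.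
  by apply: gam_switch; [apply: switch_permK|apply: switch_fpf].
have [eqp|neqp] := eqVneq (a (half u (rev_ord e))) (half v (rev_ord e)).
  have /= E := netval_contract_loop card_gt0 half_inj (@W_upd N) (@mu_upd N) mo
    aK af KU uK vK uv auv eqp.
  move: HB; rewrite /val E card_ord normcMn_nat => HB.
  rewrite -(ler_pM2r Npos); apply: le_trans HB _.
  rewrite -mulrA -exprSr ler_wpM2l // ler_weXn2l //.
  suff -> : b = c by [].
  rewrite /b /contract_perm -/c /switch_perm; have -> : c (half v e) = half v (rev_ord e).
    rewrite -auv -eqp; apply: switch_permR => //.
      by rewrite eq_sym.
    by rewrite (half_eq half_inj) // eqxx eq_sym rev_ord2_neq.
  by rewrite tperm1 conjg1.
have /= E := netval_contract_edge card_gt0 half_inj (@W_upd N) (@mu_upd N) mo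
    aK af KU uK vK uv auv neqp.
move: HB; rewrite /val E card_ord !normcMn_nat => HB.
rewrite -(ler_pM2r Npos) -(ler_pM2r Npos); apply: le_trans HB _.
rewrite -[leRHS]mulrA -expr2 -[leRHS]mulrA -exprD addn2 ler_wpM2l // ler_weXn2l //.
exact: leq_trans gbc _.
Qed.

(** Negative switches stay among the good permutations of the same [K], while positive ones join [f]
    to [g v] and are bounded by contraction. The identity thus becomes an inequality between values
    at good permutations for the same [K]. *)
Lemma bounded_step K u : K \subset VU -> u \in K ->
  (forall v, v \in K -> v != u -> forall b,
     good_perm (K :\ u :\ v) b -> bounded_at (K :\ u :\ v) b) ->
  forall a, good_perm K a -> bounded_at K a.
Proof.
move=> KU uK IH a0 ga0.
pose f := half u ord0; pose g v := half v ord0.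
pose Q (p : 'S_n * V) := [&& good_perm K p.1, p.2 \in K, p.2 != u & p.1 f == g p.2].
have [||C0 C0_ge0 [N1 HC0]] := @uniform_bound R _ Q
  (fun p N => normc (val N p.1 K)) (fun p N => N%:R ^+ gam p.1).
- by move=> p N; rewrite exprn_ge0.
- move=> [a v] /and4P[/= ga vK vu /eqP afg].
  by apply: (bounded_contract _ uK vK _ ga afg); rewrite // 1?eq_sym //; apply: IH.
(* This [k] leads to [(2 * #|V| + 1) * Y a <= #|V| * (B + Y a)], which forces [Y a <= B]. As
   [r * N = k] and [gam a <= n], the constant [B] dominates the bound [C0 * N ^ (gam a + 1)] of a
   positive switch multiplied by [r ^ (gam a + 1)]. *)
pose k := (2 * #|V| + 2)%N; pose B : R := C0 * k%:R ^+ n.+1.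
have k_ge1 : 1 <= k%:R :> R by rewrite ler1n /k addnS.
have k_gt0 : 0 < k%:R :> R by apply: lt_le_trans k_ge1.
exists B, (N1 + k)%N => N leN.
have kN : (k <= N)%N by apply: leq_trans (leq_addl _ _) leN.
have {}leN : (N1 <= N)%N by apply: leq_trans (leq_addr _ _) leN.
have N0 : (0 < N)%N by apply: leq_trans kN; rewrite /k addnS.
have card_gt0 : (0 < #|'I_N|)%N by rewrite card_ord.
have NR : 0 < N%:R :> R by rewrite ltr0n.
pose r : R := k%:R / N%:R.
have r_gt0 : 0 < r by rewrite divr_gt0.
have r_le1 : r <= 1 by rewrite ler_pdivrMr // mul1r ler_nat.
(* The maximum of Y bounds every negative switch in the identity at its
   maximiser a, because r <= 1 and a switch adds at most one component. *)
pose Y a := normc (val N a K) * r ^+ gam a.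
have [a ga amax] := @Order.TotalTheory.arg_maxP _ _ _ a0 (good_perm K) Y ga0.
have [aK af ad] := good_permP _ _ ga.
pose pl v := if a f == g v then val N a K *+ N else val N (switch_perm a f (g v)) K.
pose mi v := val N (switch_perm a f (a (g v))) K.
have SD : val N a K *+ N - val N a K = \sum_(v in K | v != u) (pl v - mi v).
  have := schwinger_dyson card_gt0 half_inj (@W_upd N)
    (fun K e i x y => @mu_SD N K e i x y N0) ord0 aK af KU uK.
  by rewrite card_ord.
have plb v : v \in K -> v != u -> normc (pl v) <= C0 * N%:R ^+ (gam a).+1.
  move=> vK vu; rewrite /pl; case: eqP => [afg|/eqP afg].
    rewrite normcMn_nat exprSr mulrA ler_wpM2r ?ler0n //.
    by apply: (HC0 (a, v)); rewrite // /Q /= ga vK vu afg /=.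
  (* The switched permutation joins [f] to [g v], so it satisfies [Q]. *)
  have /= := HC0 (switch_perm a f (g v), v) N _ leN.
  move=> H; apply: le_trans (H _) _.
    rewrite /Q /= vK vu good_plus //=; apply/eqP/switch_permL => //.
      by rewrite eq_sym.
    by rewrite (half_eq half_inj) ?(fintype.subsetP KU) // eq_sym (negPf vu).
  by rewrite ler_wpM2l // ler_weXn2l ?ler1n // gam_switch.
have mib v : v \in K -> v != u -> normc (mi v) * r ^+ (gam a).+1 <= Y a.
  move=> vK vu; apply: le_trans (amax _ (good_minus ord0 KU uK vK ga)).
  by rewrite /Y ler_wpM2l ?normc_ge0 // ler_wiXn2l ?(ltW r_gt0) // gam_switch.
have main : (N%:R - 1) * normc (val N a K) <=
    \sum_(v in K | v != u) (normc (pl v) + normc (mi v)).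
  have -> : (N%:R - 1) * normc (val N a K) = normc (val N a K *+ N - val N a K).
    have mulrn_pred (U : zmodType) (x : U) : x *+ N - x = x *+ N.-1.
      by rewrite -{1}(prednK N0) mulrSr addrK.
    by rewrite !mulrn_pred normcMn_nat mulrC.
  rewrite SD.
  apply: (big_ind2 (fun x y => normc x <= y)) => [|x1 x2 y1 y2 H1 H2|v _].
  - by rewrite ComplexField.Normc.normc0.
  - by apply: le_trans (le_normcD _ _) _; apply: lerD.
  - by apply: le_trans (le_normcD _ _) _; rewrite normcN.
have Y0 : 0 <= Y a by rewrite mulr_ge0 ?normc_ge0 // exprn_ge0 // ltW.
have B0 : 0 <= B by rewrite mulr_ge0 // exprn_ge0 // ltW.
have YB : Y a <= B.
  have S : (N%:R - 1) * r * Y a <= #|V|%:R * (B + Y a).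
    have -> : (N%:R - 1) * r * Y a = (N%:R - 1) * normc (val N a K) * r ^+ (gam a).+1.
      by rewrite /Y exprS; ring.
    apply: le_trans (ler_wpM2r _ main) _; first by rewrite exprn_ge0 // ltW.
    rewrite mulr_suml; apply: (@le_trans _ _ (\sum_(v in K | v != u) (B + Y a))).
      apply: ler_sum => v /andP[vK vu]; rewrite mulrDl lerD ?mib //.
      apply: le_trans (ler_wpM2r _ (plb v vK vu)) _; first by rewrite exprn_ge0 // ltW.
      rewrite -mulrA -exprMn /r mulrCA divff ?gt_eqF // mulr1.
      by rewrite ler_wpM2l // ler_weXn2l // ltnS gam_le.
    rewrite sumr_const -[leLHS]mulr_natl ler_wpM2r ?addr_ge0 // ler_nat.
    exact: max_card.
  (* The right side equals [k - r], and [r <= 1]. *)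
  have kr : k%:R - 1 <= (N%:R - 1) * r.
    by rewrite mulrBl mul1r /r mulrCA divff ?gt_eqF // mulr1 lerD2l lerN2.
  have kE : k%:R - 1 = 2 * #|V|%:R + 1 :> R.
    by rewrite /k natrD natrM; ring.
  have S2 : (2 * #|V|%:R + 1) * Y a <= #|V|%:R * (B + Y a).
    by apply: le_trans S; rewrite -kE ler_wpM2r.
  have V0 : 0 <= #|V|%:R :> R by [].
  rewrite -(ler_pM2l (_ : 0 < #|V|%:R + 1)) ?ltr_wpDl // mulrDl [leRHS]mulrDl mul1r.
  have : (#|V|%:R + 1) * Y a <= #|V|%:R * B by lra.
  by rewrite mulrDl mul1r => /le_trans; apply; rewrite lerDl mul1r.
have {}YB : Y a0 <= B by apply: le_trans YB; apply: amax.
have rN : r ^+ gam a0 * N%:R ^+ gam a0 = k%:R ^+ gam a0.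
  by rewrite -exprMn divfK ?gt_eqF.
apply: le_trans (_ : Y a0 * N%:R ^+ gam a0 <= _).
  rewrite /Y -mulrA rN ler_peMr ?normc_ge0 //; exact: exprn_ege1.
by rewrite ler_wpM2r // exprn_ge0 // ltW.
Qed.

Theorem netval_bounded K a : K \subset VU -> good_perm K a ->
  bounded_at K a.
Proof.
move: {2}#|K|.+1 (ltnSn #|K|) => s; elim: s K a => // s IH K a.
rewrite ltnS => Ks KU ga.
case: (finset.set_0Vmem K) => [K0|[u uK]].
  rewrite K0 in ga *; have [B HB] := base ga; exists B, 1%N => N N0.
  exact: HB.
apply: (bounded_step KU uK) ga => v vK vu b gb; apply: IH gb; last first.
  by apply: fintype.subset_trans KU; do ![apply: fintype.subset_trans (finset.subsetDl _ _) _].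
apply: leq_trans Ks; apply: leq_ltn_trans (subset_leq_card (finset.subsetDl _ _)) _.
by rewrite [X in (_ < X)%N](cardsD1 u) uK.
Qed.

End Bound.

(** * Counting connected components *)

(* The functions to bool that are constant on the components number
   2 ^ (number of components), which turns the effect of a switch on the number of
   components into linear algebra over F_2. *)
Section ComponentCount.
Variables (T : finType) (e : rel T).
Hypothesis e_sym : connect_sym e.

Lemma card_constant_colourings :
  #|[set i : {ffun T -> bool} | [forall h, forall k, e h k ==> (i h == i k)]]| =
  (2 ^ n_comp e predT)%N.
Proof.
pose rts : {set T} := [set h | roots e h].
have -> : n_comp e predT = #|rts|.
  by rewrite /n_comp_mem; apply: eq_card => h; rewrite !inE andbT.
rewrite -card_powerset; pose F (B : {set T}) := [ffun h => fingraph.root e h \in B].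
rewrite -(card_in_imset (f := F)) => [|B B' BR BR' BB']; last first.
  apply/setP => h; have [hR|hR] := boolP (h \in rts).
    move/ffunP/(_ h): BB'; rewrite !ffunE.
    by move: hR; rewrite inE => /eqP->.
  have out (A : {set T}) : A \in powerset rts -> h \notin A.
    by rewrite inE => /fintype.subsetP AR; apply: contra hR => /AR.
  by rewrite (negPf (out B BR)) (negPf (out B' BR')).
apply: eq_card => i; rewrite inE; apply/forallP/imsetP => [ie|[B _ ->] h]; last first.
  apply/forallP => k; apply/implyP => hk; rewrite !ffunE.
  by rewrite (fingraph.rootP e_sym (connect1 hk)).
exists [set h in rts | i h].
  by rewrite inE; apply/fintype.subsetP => h; rewrite inE => /andP[].
have ic h k : connect e h k -> i h = i k.
  case/connectP => p; elim: p h => [h _ -> //|x p IH h /= /andP[hx xp] kE].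
  have /forallP/(_ x)/implyP/(_ hx)/eqP-> := ie h; exact: IH.
apply/ffunP => h; rewrite !ffunE !inE roots_root // /=.
exact/ic/connect_root.
Qed.

End ComponentCount.

Section Components.
Variables (n : nat) (s : 'S_n).
Implicit Types (a : 'S_n) (f g h k : 'I_n).

Definition adj a : rel 'I_n :=
  fun h k => (k \in porbit s h) || (k \in porbit a h).

Definition ncomp a : nat := n_comp (adj a) predT.

Definition invariants a :=
  [set i : {ffun 'I_n -> bool} | compat s i && compat a i].

Lemma ncomp_le a : (ncomp a <= n)%N.
Proof. by rewrite -[X in (_ <= X)%N]card_ord max_card. Qed.

Lemma adj_sym a : connect_sym (adj a).
Proof.
by apply: sym_connect_sym => h k; rewrite /adj porbit_sym (porbit_sym a).
Qed.

Lemma adj_s a h : adj a h (s h).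
Proof. by apply/orP; left; apply: (mem_porbit s 1 h). Qed.

Lemma adj_a a h : adj a h (a h).
Proof. by apply/orP; right; apply: (mem_porbit a 1 h). Qed.

Lemma compat_porbit (X : finType) a (i : {ffun 'I_n -> X}) h k :
  compat a i -> k \in porbit a h -> i h = i k.
Proof.
move=> /compatP ai /porbitP[d ->]; elim: d => [|d IH]; first by rewrite perm1.
by rewrite expgSr permM ai.
Qed.

Lemma card_invariants a : #|invariants a| = (2 ^ ncomp a)%N.
Proof.
rewrite -(card_constant_colourings (adj_sym a)); apply: eq_card => i; rewrite !inE.
apply/andP/forallP => [[si ai] h|H].
  apply/forallP => k; apply/implyP => /orP[] hk; apply/eqP.
    exact: compat_porbit hk.
  exact: compat_porbit hk.
have {}H h k : adj a h k -> i k = i h.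
  by move: (H h) => /forallP/(_ k)/implyP Hh /Hh/eqP.
by split; apply/compatP => h; apply: H; [apply: adj_s | apply: adj_a].
Qed.

Definition xorf (i j : {ffun 'I_n -> bool}) := [ffun h => i h (+) j h].

Lemma xorfK j : involutive (xorf j).
Proof. by move=> i; apply/ffunP => h; rewrite !ffunE addKb. Qed.

Lemma xorf_compat a i j : compat a i -> compat a j -> compat a (xorf i j).
Proof. by move=> /compatP ai /compatP aj; apply/compatP => h; rewrite !ffunE ai aj. Qed.

Section Switch.
Variables (a : 'S_n) (f g : 'I_n).
Hypotheses (aK : involutive a) (a_fpf : forall h, a h != h).
Hypotheses (fg : f != g) (afg : a f != g).
Let b := switch_perm a f g.
(** The kernel of a linear form on the invariants of [b]. On it the four switched ends share one
    colour, so its elements are invariants of [a] as well. *)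
Let core := [set i in invariants b | i f == i (a f)].

Let core_sub : core \subset invariants a.
Proof.
apply/fintype.subsetP => i; rewrite !inE (compat_switch aK a_fpf i fg afg) (compat_four aK i fg afg).
by case/andP => /andP[-> /and3P[/eqP<- /eqP <- ->]] /eqP<-; rewrite !eqxx.
Qed.

Let card_b_le : (#|invariants b| <= #|core| + #|core|)%N.
Proof.
rewrite -(cardsID core (invariants b)) leq_add //.
  by apply: subset_leq_card; apply: finset.subsetIr.
case: (finset.set_0Vmem (invariants b :\: core)) => [->|[i0 i0P]].
  by rewrite cards0.
(* Adding one fixed invariant outside [core] maps all the others outside [core] into it: the index
   is at most two. *)
rewrite -(card_imset _ (inv_inj (xorfK i0))); apply: subset_leq_card.
move: i0P; rewrite !inE => /andP[nf bi0]; rewrite bi0 /= in nf.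
apply/fintype.subsetP => _ /imsetP[i iP ->].
move: iP; rewrite !inE => /andP[nif bi]; rewrite bi /= in nif.
case/andP: bi bi0 => [si bi] /andP[si0 bi0].
rewrite !xorf_compat //= !ffunE.
by move: nf nif; do 4![case: (fun_of_fin _ _)].
Qed.

Lemma ncomp_switch_aux : (ncomp b <= (ncomp a).+1)%N.
Proof.
rewrite -(leq_exp2l _ _ (isT : 1 < 2)%N) -card_invariants expnS -card_invariants mul2n -addnn.
by apply: leq_trans card_b_le _; rewrite leq_add // subset_leq_card.
Qed.

(** The indicator of the component of [f] is an invariant of [a] that separates [f] from [g]. Adding
    it to the elements of [core] leaves [core], whose index in the invariants of [a] is therefore at
    least two; this offsets its index in those of [b]. *)
Lemma ncomp_switch_disconnected :
  ~~ connect (adj a) f g -> (ncomp b <= ncomp a)%N.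
Proof.
move=> nfg; rewrite -(leq_exp2l _ _ (isT : 1 < 2)%N).
rewrite -(card_invariants b) -(card_invariants a).
apply: leq_trans card_b_le _.
pose c := [ffun h => connect (adj a) f h].
have cinv : c \in invariants a.
  have cc h k : adj a h k -> c k = c h.
    by move=> /connect1 hk; rewrite !ffunE (same_connect_r (adj_sym a) hk).
  rewrite inE; apply/andP; split; apply/compatP => h; apply: cc.
    exact: adj_s.
  exact: adj_a.
rewrite -(cardsID core (invariants a)) (finset.setIidPr core_sub) leq_add2l.
rewrite -(card_imset _ (inv_inj (xorfK c))); apply: subset_leq_card.
apply/fintype.subsetP => _ /imsetP[i iP ->].
have := fintype.subsetP core_sub _ iP; rewrite !inE in iP cinv *.
case/andP: cinv => sc ac /andP[si ai].
rewrite (xorf_compat sc si) (xorf_compat ac ai) /=.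
have bf : b f = g by apply: switch_permL; rewrite // eq_sym.
case/andP: iP => /andP[_ /compatP/(_ f)]; rewrite bf => ig _.
rewrite andbT; apply/negP => /andP[/compatP/(_ f) bx _]; move: bx; rewrite bf !ffunE ig connect0 (negPf nfg).
by case: (i f).
Qed.

End Switch.

Lemma ncomp_switch a f g : involutive a -> (forall h, a h != h) ->
  (ncomp (switch_perm a f g) <= (ncomp a).+1)%N.
Proof.
move=> aK af; have [<-|fg] := eqVneq f g; first by rewrite switch_perm_id.
have [<-|afg] := eqVneq (a f) g.
  by rewrite /switch_perm tperm1 conjg1.
exact: ncomp_switch_aux.
Qed.

End Components.

(** * Moments of a Haar orthogonal matrix *)

Lemma deriv_bigprod (R : comNzRingType) (I : finType) (K : {set I})
    (F : I -> {poly R}) :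
  (\prod_(v in K) F v)^`() =
  \sum_(v in K) (F v)^`() * \prod_(w in K | w != v) F w.
Proof.
have seqP (r : seq I) : uniq r -> (\prod_(v <- r) F v)^`() =
    \sum_(v <- r) (F v)^`() * \prod_(w <- r | w != v) F w.
  elim: r => [_|x r IH /= /andP[xr ur]]; first by rewrite !big_nil derivC.
  rewrite !big_cons derivM IH // eqxx /=; congr (_ * _ + _).
    rewrite big_seq [RHS]big_seq_cond; apply: eq_bigl => w; case: eqP => [->|_].
      by rewrite (negPf xr).
    by rewrite andbT.
  rewrite mulr_sumr !big_seq; apply: eq_bigr => v vr.
  by rewrite big_cons ifT 1?mulrCA //; apply: contraNneq xr => ->.
have := seqP _ (enum_uniq K); rewrite !big_enum => ->.
by apply: eq_bigr => v _; rewrite -big_enum_cond.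
Qed.

Lemma eq_poly_horner (R : numDomainType) (p q : {poly R}) :
  (forall t, p.[t] = q.[t]) -> p = q.
Proof.
move=> pq; apply/eqP; rewrite -subr_eq0; apply/eqP.
pose r : seq R := [seq n%:R | n <- iota 0 (size (p - q))].
apply: (@roots_geq_poly_eq0 _ _ r); last by rewrite size_map size_iota.
  by apply/allP => t _; rewrite rootE hornerD hornerN pq subrr.
by rewrite map_inj_uniq ?iota_uniq // => n m /eqP; rewrite eqr_nat => /eqP.
Qed.

Lemma sum_ffun_delta (R : comPzSemiRingType) (V X : finType) (a : {ffun V -> X})
    (v : V) (G : {ffun V -> X} -> R) :
  \sum_(c : {ffun V -> X}) (\prod_(w | w != v) (c w == a w)%:R) * G c =
  \sum_z G (upd a v z).
Proof.
rewrite (bigID (fun c : {ffun V -> X} => upd a v (c v) == c)) /=.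
rewrite [X in _ + X]big1 ?addr0 => [|c cN].
  rewrite (reindex_onto (upd a v) (fun c : {ffun V -> X} => c v)) /=.
    apply: eq_big => [z|z _]; first by rewrite updE !eqxx.
    rewrite big1 ?mul1r // => w wv; by rewrite updE (negPf wv) eqxx.
  by move=> c /eqP.
have [w cw] : exists w, upd a v (c v) w != c w.
  apply/existsP; rewrite -negb_forall; apply: contra cN => /forallP ac.
  by apply/eqP/ffunP => w; apply/eqP.
have wv : w != v by apply: contraNneq cw => ->; rewrite updE eqxx.
move: cw; rewrite updE (negPf wv) eq_sym => /negPf cw.
by rewrite (bigD1 w) //= cw !mul0r.
Qed.

Section BoundedExpectation.
Context d (T : measurableType d) (R : realType) (P : probability T R).
Implicit Types X : T -> R.

Definition bounded_rv X :=
  measurable_fun [set: T] X /\ exists M, forall t, `|X t| <= M.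

Definition mean X : R := \int[P]_t X t.

Lemma bounded_rv_integrable X : bounded_rv X -> P.-integrable [set: T] (EFin \o X).
Proof.
case=> mX [M XM]; apply: measurable_bounded_integrable => //.
  exact: le_lt_trans (probability_le1 P measurableT) (ltry 1).
exists M; split; first by rewrite num_real.
by move=> y My t _ /=; apply: le_trans (XM t) _; apply: ltW.
Qed.

Lemma bounded_rv_cst r : bounded_rv (cst r).
Proof. by split; [exact: measurable_cst | exists `|r|]. Qed.

Lemma bounded_rvD X Y :
  bounded_rv X -> bounded_rv Y -> bounded_rv (fun t => X t + Y t).
Proof.
move=> [mX [M XM]] [mY [M' YM]]; split; first exact: measurable_realfun.measurable_funD.
by exists (M + M') => t; apply: le_trans (ler_normD _ _) _; apply: lerD.
Qed.

Lemma bounded_rvM X Y :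
  bounded_rv X -> bounded_rv Y -> bounded_rv (fun t => X t * Y t).
Proof.
move=> [mX [M XM]] [mY [M' YM]]; split; first exact: measurable_realfun.measurable_funM.
by exists (M * M') => t; rewrite normrM; apply: ler_pM.
Qed.

Lemma bounded_rv_prod (I : Type) (r : seq I) (Q : pred I) (X : I -> T -> R) :
  (forall j, bounded_rv (X j)) ->
  bounded_rv (fun t => \prod_(j <- r | Q j) X j t).
Proof.
move=> bX; elim: r => [|j r IH].
  by under eq_fun do rewrite big_nil; exact: bounded_rv_cst.
under eq_fun do rewrite big_cons; case: (Q j) => //.
exact: bounded_rvM.
Qed.

Lemma bounded_rv_sum (I : Type) (r : seq I) (Q : pred I) (X : I -> T -> R) :
  (forall j, bounded_rv (X j)) ->
  bounded_rv (fun t => \sum_(j <- r | Q j) X j t).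
Proof.
move=> bX; elim: r => [|j r IH].
  by under eq_fun do rewrite big_nil; exact: bounded_rv_cst.
under eq_fun do rewrite big_cons; case: (Q j) => //.
exact: bounded_rvD.
Qed.

Lemma mean_cst r : mean (cst r) = r.
Proof.
by rewrite /mean Rintegral_cst //= probability_setT mulr1.
Qed.

Lemma mean_sum (I : Type) (r : seq I) (Q : pred I) (c : I -> R) (X : I -> T -> R) :
  (forall j, bounded_rv (X j)) ->
  mean (fun t => \sum_(j <- r | Q j) c j * X j t) =
  \sum_(j <- r | Q j) c j * mean (X j).
Proof.
move=> bX; have bcX j : bounded_rv (fun t => c j * X j t).
  by apply: bounded_rvM => //; exact: bounded_rv_cst.
elim: r => [|j r IH].
  by rewrite big_nil -[RHS](mean_cst 0); congr mean; apply/funext => t; rewrite big_nil.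
have -> : (fun t => \sum_(j <- j :: r | Q j) c j * X j t) =
    (fun t => (if Q j then c j * X j t else 0) + \sum_(j <- r | Q j) c j * X j t).
  by apply/funext => t; rewrite big_cons; case: ifP => //; rewrite add0r.
rewrite big_cons; case: (Q j) => /=; last first.
  by rewrite -IH; congr mean; apply/funext => t; rewrite add0r.
rewrite /mean RintegralD //; [|exact/bounded_rv_integrable|]; last first.
  by apply/bounded_rv_integrable/bounded_rv_sum.
by rewrite RintegralZl //; [congr (_ + _)|exact: bounded_rv_integrable].
Qed.

End BoundedExpectation.

Section HaarMoments.
Context d (T : measurableType d) (R : realType) (P : probability T R).
Variables (N : nat) (U : T -> 'M[R]_N).
Hypothesis hU : haar_orthogonal P U.
Variable V : finType.
Implicit Types (K : {set V}) (a b c : {ffun V -> 'I_N}).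

(** Matrices with the Borel sets of [haar_orthogonal], so that [U] and the monomials become
    measurable functions. *)
Let M := g_sigma_algebraType (@open 'M[R]_N).

Let measurable_coord (x y : 'I_N) :
  measurable_fun [set: M] (fun A : M => (A : 'M[R]_N) x y).
Proof.
apply: (measurability _ (measurable_realfun.RGenOpens.measurableE R)) => //.
move=> _ [_ [l [r ->] <-]]; rewrite setTI; apply: sub_sigma_algebra.
have /continuousP := @coord_continuous R N N x y; apply.
exact: interval_open.
Qed.

Let measurable_U : measurable_fun [set: T] (U : T -> M).
Proof. by move=> _ B mB; rewrite setTI; case: hU => _ + _; apply. Qed.

Lemma orthogonal_mx_le1 (A : 'M[R]_N) x y : orthogonal_mx A -> `|A x y| <= 1.
Proof.
move=> /matrixP/(_ x x); rewrite !mxE eqxx => AA.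
have : A x y ^+ 2 <= 1.
  rewrite -[leRHS]AA (bigD1 y) //= !mxE -expr2 lerDl.
  by apply: sumr_ge0 => j _; rewrite !mxE -expr2 sqr_ge0.
by move=> A2; rewrite -(@expr_le1 _ 2) // real_normK // num_real.
Qed.

Let monom K a b (A : 'M[R]_N) := \prod_(v in K) A (a v) (b v).

Definition moment K a b : R := mean P (fun t => monom K a b (U t)).

Let orthU t : orthogonal_mx (U t). Proof. by case: hU => + _ _; apply. Qed.

Lemma bounded_rv_entry x y : bounded_rv (fun t => U t x y).
Proof.
split; last by exists 1 => t; apply: orthogonal_mx_le1.
exact: (measurableT_comp (measurable_coord x y) measurable_U).
Qed.

Lemma bounded_rv_monom K a b : bounded_rv (fun t => monom K a b (U t)).
Proof. by apply: bounded_rv_prod => v; apply: bounded_rv_entry. Qed.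

Lemma eq_moment K a b a' b' : {in K, a =1 a'} -> {in K, b =1 b'} ->
  moment K a b = moment K a' b'.
Proof.
move=> aa bb; congr mean; apply/funext => t; apply: eq_bigr => v vK.
by rewrite aa // bb.
Qed.

Let measurable_monom K a b : measurable_fun [set: M] (monom K a b : M -> R).
Proof.
rewrite /monom; under eq_fun do rewrite big_mkcond /=.
apply: measurable_prod => v _; case: (v \in K) => //; exact: measurable_cst.
Qed.

(** The Haar property compares probabilities of preimages only. Both means are rewritten as
    integrals of the identity against the laws of two real random variables, and these laws agree on
    every set. *)
Lemma mean_monom_mul (O : 'M[R]_N) K a b : orthogonal_mx O ->
  mean P (fun t => monom K a b (O *m U t)) = moment K a b.
Proof.
move=> oO; have [_ _ hinv] := hU.
pose X t := monom K a b (U t); pose Y t := monom K a b (O *m U t).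
have bX : bounded_rv X by apply: bounded_rv_monom.
have bY : bounded_rv Y.
  apply: bounded_rv_prod => v; under eq_fun do rewrite mxE.
  apply: bounded_rv_sum => z; apply: bounded_rvM; first exact: bounded_rv_cst.
  exact: bounded_rv_entry.
have [[mX _] [mY _]] := (bX, bY).
congr fine; rewrite -/X -/Y.
have -> : (\int[P]_t (Y t)%:E)%E = (\int[pushforward P Y]_y y%:E)%E.
  by rewrite integral_pushforward //; apply: bounded_rv_integrable.
have -> : (\int[P]_t (X t)%:E)%E = (\int[pushforward P X]_y y%:E)%E.
  by rewrite integral_pushforward //; apply: bounded_rv_integrable.
apply: eq_measure_integral => B mB _.
have mB' : (<<s @open 'M[R]_N >> (monom K a b @^-1` B))%classic.
  by rewrite -[X in (<<s _ >> X)%classic]setTI; exact: measurable_monom.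
exact: (hinv O _ oO mB').
Qed.

(** Expanding each entry of [O *m U] chooses a row at every vertex of [K]. Functions on all of [V]
    are used for this, frozen to [z0] off [K] so that each choice is counted once. *)
Lemma moment_left (O : 'M[R]_N) K a b (z0 : {ffun V -> 'I_N}) : orthogonal_mx O ->
  \sum_(c : {ffun V -> 'I_N}) (\prod_(v in K) O (a v) (c v)) * 
    (\prod_(v | v \notin K) (c v == z0 v)%:R) * moment K c b = moment K a b.
Proof.
move=> oO; rewrite -(mean_monom_mul K a b oO).
rewrite -(mean_sum P _ _ _ (fun c => bounded_rv_monom K c b)).
congr mean; apply/funext => t; symmetry.
pose F v z := if v \in K then O (a v) z * U t z (b v) else (z == z0 v)%:R.
transitivity (\prod_v \sum_z F v z).
  rewrite /monom big_mkcond; apply: eq_bigr => v _; rewrite /F.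
  case: (v \in K); first by rewrite mxE.
  by rewrite -[RHS]/(\sum_z _) (bigD1 (z0 v)) //= eqxx big1 ?addr0 // => z /negPf->.
rewrite bigA_distr_bigA; apply: eq_bigr => c _ /=.
rewrite (bigID (mem K)) /= /monom mulrAC -big_split /=; congr (_ * _).
  by apply: eq_bigr => v vK; rewrite /F vK.
by apply: eq_bigr => v /negPf vK; rewrite /F vK.
Qed.

(* Convolving the law of U with that of its transpose gives both of them, which
   is how uniqueness of the Haar measure is proved; on monomials this is a
   finite sum and requires no Fubini theorem. *)
Lemma moment_sym K a b : moment K a b = moment K b a.
Proof.
pose z0 : {ffun V -> 'I_N} := a.
pose D (c : {ffun V -> 'I_N}) : R := \prod_(v | v \notin K) (c v == z0 v)%:R.
(* [moment_left] is applied, for each outcome [t], with the transpose of [U t] as the orthogonal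
   matrix, and then averaged over [t]. The resulting sum is symmetric in [a'] and [b']. *)
have key a' b' :
    \sum_c D c * moment K c b' * moment K c a' = moment K a' b'.
  rewrite -[RHS](mean_cst P).
  have -> : cst (moment K a' b') = (fun t : T =>
      \sum_c (D c * moment K c b') * monom K c a' (U t)).
    apply/funext => t; rewrite /cst -(@moment_left (U t)^T K a' b' z0).
      apply: eq_bigr => c _; rewrite [RHS]mulrC mulrA; congr (_ * _ * _).
      by apply: eq_bigr => v _; rewrite mxE.
    by rewrite /orthogonal_mx /= trmxK; apply: mulmx1C; apply: orthU.
  by rewrite mean_sum // => c; apply: bounded_rv_monom.
rewrite -key -[RHS]key; apply: eq_bigr => c _.
by rewrite -!mulrA [X in _ * X]mulrC.
Qed.

(** The repeated index is a row index, so this is [U^T *m U = 1], which holds for each outcome;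
    columns are reached later through [moment_sym]. *)
Lemma moment_orth K v w a b : v \in K -> w \in K -> v != w ->
  \sum_x moment K (upd (upd a v x) w x) b =
  (b v == b w)%:R * moment (K :\ v :\ w) a b.
Proof.
move=> vK wK vw.
have wKv : w \in K :\ v by rewrite !inE eq_sym vw.
have bm := bounded_rv_monom.
transitivity (\sum_x 1 * moment K (upd (upd a v x) w x) b).
  by apply: eq_bigr => x _; rewrite mul1r.
rewrite -mean_sum => [|x]; last exact: bm.
transitivity (\sum_(i < 1) (b v == b w)%:R * moment (K :\ v :\ w) a b); last first.
  by rewrite big_ord1.
rewrite -mean_sum => [|_]; last exact: bm.
congr mean; apply/funext => t; rewrite big_ord1.
have -> : (b v == b w)%:R = \sum_x U t x (b v) * U t x (b w).
  have /mulmx1C/matrixP/(_ (b v) (b w)) := orthU t.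
  by rewrite !mxE => <-; apply: eq_bigr => x _; rewrite mxE.
rewrite mulr_suml; apply: eq_bigr => x _; rewrite mul1r.
rewrite {1}/monom (big_setD1 v) // (big_setD1 w) //= mulrA.
rewrite !updE !eqxx (negPf vw); congr (_ * _); apply: eq_bigr => z.
by rewrite !inE => /and3P[/negPf zw /negPf zv _]; rewrite !updE zw zv.
Qed.

(** [A] and [E] are projections annihilating each other and [Q] is a quarter turn in the image of
    [E]. Keeping the matrices abstract leaves an identity between entries that [ring] proves. *)
Lemma rotation_product (A E Q : 'M[R]_N) (r s t : R) :
  A *m A = A -> E *m E = E -> Q *m Q = - E -> E *m Q = Q -> Q *m E = Q ->
  A *m E = 0 -> E *m A = 0 -> A *m Q = 0 -> Q *m A = 0 ->
  (r *: A + s *: E + t *: Q) *m (r *: A + s *: E - t *: Q) =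
  r ^+ 2 *: A + (s ^+ 2 + t ^+ 2) *: E.
Proof.
move=> AA EE QQ EQ QE AE EA AQ QA.
rewrite !mulmxDl !mulmxDr !mulmxN -!scalemxAl -!scalemxAr.
rewrite AA AE EA AQ QA EE EQ QE QQ.
by apply/matrixP => i j; rewrite !mxE; ring.
Qed.

Section Rotation.
Variables (x y : 'I_N).
Hypothesis xy : x != y.
Let E : 'M[R]_N := delta_mx x x + delta_mx y y.
Let Q : 'M[R]_N := delta_mx x y - delta_mx y x.

(* (1 + t^2) times the rotation of angle 2 * atan t in the plane (x, y), so
   that its entries are polynomials in t. *)
Let rot (t : R) : 'M[R]_N := (1 + t ^+ 2) *: (1%:M - E) + (1 - t ^+ 2) *: E + (2 * t) *: Q.

Let yx : (y == x) = false. Proof. by rewrite eq_sym (negPf xy). Qed.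

Let EE : E *m E = E.
Proof.
rewrite /E mulmxDl !mulmxDr !mul_delta_mx_cond !eqxx yx (negPf xy).
by rewrite !mulr0n !mulr1n addr0 add0r.
Qed.

Let QQ : Q *m Q = - E.
Proof.
rewrite /Q /E mulmxBl !mulmxBr !mul_delta_mx_cond !eqxx yx (negPf xy).
by rewrite !mulr0n !mulr1n subr0 sub0r opprD addrC.
Qed.

Let EQ : E *m Q = Q.
Proof.
rewrite /Q /E mulmxDl !mulmxBr !mul_delta_mx_cond !eqxx yx (negPf xy).
by rewrite !mulr0n !mulr1n subr0 sub0r.
Qed.

Let QE : Q *m E = Q.
Proof.
rewrite /Q /E mulmxBl !mulmxDr !mul_delta_mx_cond !eqxx yx (negPf xy).
by rewrite !mulr0n !mulr1n addr0 add0r.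
Qed.

Let rot_tr t : (rot t)^T = (1 + t ^+ 2) *: (1%:M - E) + (1 - t ^+ 2) *: E - (2 * t) *: Q.
Proof.
have ET : E^T = E by rewrite /E linearD /= !trmx_delta.
have QT : Q^T = - Q by rewrite /Q linearB /= !trmx_delta opprB.
rewrite /rot; move: E Q ET QT => E' Q' ET QT.
apply/matrixP => i j; move/matrixP/(_ i j): ET; move/matrixP/(_ i j): QT.
by rewrite !mxE [j == i]eq_sym => -> ->; ring.
Qed.

Let rot_orth t : orthogonal_mx ((1 + t ^+ 2)^-1 *: rot t).
Proof.
have t0 : 1 + t ^+ 2 != 0 by rewrite gt_eqF // ltr_pwDl // sqr_ge0.
rewrite /orthogonal_mx /= linearZ /= -scalemxAl -scalemxAr scalerA rot_tr.
set A := 1%:M - E.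
have AA : A *m A = A.
  by rewrite /A mulmxBl mul1mx mulmxBr mulmx1 EE subrr subr0.
have AE : A *m E = 0 by rewrite /A mulmxBl mul1mx EE subrr.
have EA : E *m A = 0 by rewrite /A mulmxBr mulmx1 EE subrr.
have AQ : A *m Q = 0 by rewrite /A mulmxBl mul1mx EQ subrr.
have QA : Q *m A = 0 by rewrite /A mulmxBr mulmx1 QE subrr.
rewrite /rot -/A rotation_product // -expr2.
have -> : (1 - t ^+ 2) ^+ 2 + (2 * t) ^+ 2 = (1 + t ^+ 2) ^+ 2 by ring.
by rewrite -scalerDr subrK scalerA -exprMn mulVf // expr1n scale1r.
Qed.

Let rotp (p q : 'I_N) : {poly R} :=
  (1 + 'X^2) * ((1%:M - E) p q)%:P + (1 - 'X^2) * (E p q)%:P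
  + (2%:R *: 'X) * (Q p q)%:P.

Let rotpE p q t : (rotp p q).[t] = rot t p q.
Proof.
rewrite /rotp /rot; move: E Q => E' Q'.
by rewrite !mxE !hornerE.
Qed.

Let rotp0 p q : (rotp p q).[0] = (p == q)%:R.
Proof. by rewrite rotpE /rot; move: E Q => E' Q'; rewrite !mxE; ring. Qed.

Let rotp1 p q : (rotp p q)^`().[0] = 2 * Q p q.
Proof.
rewrite /rotp; move: E Q => E' Q'.
by rewrite !poly.derivE !hornerE /= oppr0 mul0r add0r addr0.
Qed.

Let QE2 p q : Q p q = (p == x)%:R * (q == y)%:R - (p == y)%:R * (q == x)%:R.
Proof. by rewrite /Q !mxE -!natrM !mulnb. Qed.

(** Multiplied by [(1 + t ^ 2) ^ #|K|], the invariance under the rotations becomes an equality of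
    polynomials in [t], and the relation is its derivative at 0. No differentiation under the
    integral is involved. *)
Lemma moment_SD_neq K a b :
  \sum_(v in K) ((a v == x)%:R * moment K (upd a v y) b
                 - (a v == y)%:R * moment K (upd a v x) b) = 0.
Proof.
pose D (c : {ffun V -> 'I_N}) : R := \prod_(v | v \notin K) (c v == a v)%:R.
pose lhs : {poly R} :=
  \sum_c (D c * moment K c b) *: \prod_(v in K) rotp (a v) (c v).
have lhsE : lhs = moment K a b *: (1 + 'X^2) ^+ #|K|.
  apply: eq_poly_horner => t; rewrite horner_sum !hornerE.
  have t0 : 1 + t ^+ 2 != 0 by rewrite gt_eqF // ltr_pwDl // sqr_ge0.
  rewrite -(@moment_left _ K a b a (rot_orth t)) mulr_suml; apply: eq_bigr => c _.
  rewrite hornerZ horner_prod.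
  have -> : \prod_(v in K) ((1 + t ^+ 2)^-1 *: rot t) (a v) (c v) =
      (1 + t ^+ 2) ^- #|K| * \prod_(v in K) rot t (a v) (c v).
    rewrite -exprVn -prodr_const -big_split /=; apply: eq_bigr => v _.
    by rewrite [LHS]mxE.
  under eq_bigr do rewrite rotpE.
  rewrite -/(D c); set p := \prod_(_ in _) _.
  have k0 : (1 + t ^+ 2) ^+ #|K| != 0 by rewrite expf_neq0.
  by field.
(* The other side is a polynomial in [t ^ 2], so its derivative vanishes at 0. *)
have: lhs^`().[0] = 0.
  rewrite lhsE derivZ deriv_exp !poly.derivE !hornerE.
  by rewrite hornerMn hornerM hornerD hornerX addr0 mul0r mul0rn mulr0.
rewrite /lhs raddf_sum /= horner_sum => S0.
have {S0} : \sum_c \sum_(v in K) D c * moment K c b *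
    (2 * Q (a v) (c v) * \prod_(w in K | w != v) (a w == c w)%:R) = 0.
  apply: etrans S0; apply: eq_bigr => c _.
  rewrite derivZ hornerZ deriv_bigprod horner_sum mulr_sumr.
  apply: eq_bigr => v _; rewrite hornerM horner_prod rotp1.
  by congr (_ * (_ * _)); apply: eq_bigr => w _; rewrite rotp0.
rewrite exchange_big /= => S.
(* The factor 2 is the speed at 0 of the angle [2 * atan t]. *)
apply: (mulfI (_ : 2 != 0 :> R)); first by rewrite pnatr_eq0.
rewrite mulr0; apply: etrans S; rewrite mulr_sumr; apply: eq_bigr => v vK.
pose G (c : {ffun V -> 'I_N}) := 2 * Q (a v) (c v) * moment K c b.
transitivity (\sum_z G (upd a v z)).
  rewrite /G; under eq_bigr do rewrite QE2 updE eqxx.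
  rewrite -(sum_delta y (fun z => (a v == x)%:R * moment K (upd a v z) b)).
  rewrite -(sum_delta x (fun z => (a v == y)%:R * moment K (upd a v z) b)).
  by rewrite -sumrB mulr_sumr; apply: eq_bigr => z _; ring.
rewrite -sum_ffun_delta; apply: eq_bigr => c _.
rewrite (bigID (mem K)) /= /G /D.
have -> : \prod_(w in K | w != v) (a w == c w)%:R =
    \prod_(w | (w != v) && (w \in K)) (c w == a w)%:R :> R.
  by apply: eq_big => [w|w _]; [rewrite andbC | rewrite eq_sym].
have -> : \prod_(w | (w != v) && (w \notin K)) (c w == a w)%:R =
    \prod_(w | w \notin K) (c w == a w)%:R :> R.
  by apply: eq_bigl => w; case: eqP => // ->; rewrite vK.
ring.
Qed.

End Rotation.

Lemma moment_SD x y K a b :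
  \sum_(v in K) ((a v == x)%:R * moment K (upd a v y) b
                 - (a v == y)%:R * moment K (upd a v x) b) = 0.
Proof.
have [<-|xy] := eqVneq x y; last exact: moment_SD_neq.
by rewrite big1 // => v _; rewrite subrr.
Qed.

End HaarMoments.

(** * Embedding a map into a map with additional loops *)

Section Cycles.
Variables (n : nat) (s : 'S_n).
Implicit Types (c : pcycle s) (h k : 'I_n).

Lemma pcycle_val c : val c = porbit s (pcycle_least c).
Proof. by rewrite -[in LHS](pcycle_of_least c). Qed.

Lemma pcycle_of_eq c h : h \in val c -> pcycle_of s h = c.
Proof.
rewrite pcycle_val => hc; apply: val_inj; rewrite [RHS]pcycle_val /=.
by apply/eqP; rewrite eq_porbit_mem.
Qed.

Lemma pcycle_ofP h k : pcycle_of s h = pcycle_of s k <-> h \in porbit s k.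
Proof.
split=> [/(congr1 val) /= <-|hk]; first exact: porbit_id.
exact: pcycle_of_eq.
Qed.

Lemma pcycle_of_s h : pcycle_of s (s h) = pcycle_of s h.
Proof. by apply/pcycle_ofP; apply: (mem_porbit s 1 h). Qed.

Lemma pcycle_listE c :
  pcycle_list c = traject s (pcycle_least c) (pcycle_len c) :> seq 'I_n.
Proof.
apply: (@eq_from_nth _ (pcycle_least c)); first by rewrite size_tuple size_traject.
rewrite size_tuple => k kc; rewrite nth_traject // -permX.
by rewrite (nth_mktuple _ _ (Ordinal kc)).
Qed.

Lemma pcycle_least_min c h : h \in val c -> (pcycle_least c <= h)%N.
Proof.
rewrite /pcycle_least; case: arg_minnP => [|k kc kmin]; last exact: kmin.
exact: (xchooseP (pcycle_neq0 c)).
Qed.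

Lemma pcycle_least_eq c h :
  h \in val c -> (forall k, k \in val c -> (h <= k)%N) -> pcycle_least c = h.
Proof.
move=> hc hmin; apply/val_inj/eqP; rewrite eqn_leq pcycle_least_min //=.
exact/hmin/pcycle_least_in.
Qed.

Lemma mem_pcycle_list c h : (h \in (pcycle_list c : seq _)) = (h \in val c).
Proof. by rewrite pcycle_listE /pcycle_len pcycle_val porbit_traject. Qed.

Lemma uniq_pcycle_list c : uniq (pcycle_list c).
Proof. by rewrite pcycle_listE /pcycle_len pcycle_val uniq_traject_porbit. Qed.

End Cycles.

Section EdgeSum.
Variables (m : cmap) (X : finType) (C : nmodType).

(** An index type that depends on [eperm m], and so changes under a switch, is traded for a
    condition on a fixed type. *)
Lemma sum_edge (F : {ffun 'I_(nhalf m) -> X} -> C) :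
  \sum_(i : {ffun edge m -> X}) F [ffun h => i (pcycle_of (eperm m) h)] =
  \sum_(i | compat (eperm m) i) F i.
Proof.
rewrite [RHS](reindex_onto
  (fun i : {ffun edge m -> X} => [ffun h => i (pcycle_of (eperm m) h)])
  (fun j => [ffun c => j (pcycle_least c)])) /=.
  apply: eq_bigl => i; apply/esym/andP; split.
    by apply/compatP => h; rewrite !ffunE pcycle_of_s.
  by apply/eqP/ffunP => c; rewrite !ffunE pcycle_of_least.
move=> j jm; apply/ffunP => h; rewrite !ffunE.
apply: compat_porbit jm _; rewrite porbit_sym.
exact: (pcycle_least_in (pcycle_of (eperm m) h)).
Qed.

End EdgeSum.

Section Embedding.
Variables (n0 n : nat) (s0 a0 : 'S_n0) (s a : 'S_n) (j : 'I_n0 -> 'I_n).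
Hypothesis j_mono : {mono j : h k / (h <= k)%N}.
Hypothesis j_s : forall h, j (s0 h) = s (j h).
Hypothesis j_a : forall h, j (a0 h) = a (j h).
Hypothesis aK : involutive a.

Lemma j_inj : injective j.
Proof. by move=> h k hk; apply/val_inj/eqP; rewrite eqn_leq -!j_mono hk leqnn. Qed.

Lemma porbit_emb h : porbit s (j h) = j @: porbit s0 h.
Proof.
have sX d k : (s ^+ d)%g (j k) = j ((s0 ^+ d)%g k).
  elim: d k => [|d IH] k; first by rewrite !expg0 !perm1.
  by rewrite !expgSr !permM IH j_s.
apply/setP => k; apply/porbitP/imsetP => [[d ->]|[k' /porbitP[d ->] ->]].
  by exists ((s0 ^+ d)%g h) => //; apply: mem_porbit.
by exists d.
Qed.

(** Since [j] is increasing, least elements go to least elements, so the lists of half-edges keep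
    their starting points and the tensors are read in the same order. *)
Definition emb_cycle (c : pcycle s0) : pcycle s := pcycle_of s (j (pcycle_least c)).

Lemma emb_cycle_val c : val (emb_cycle c) = j @: val c.
Proof. by rewrite /= porbit_emb pcycle_val. Qed.

Lemma emb_cycle_least c : pcycle_least (emb_cycle c) = j (pcycle_least c).
Proof.
apply: pcycle_least_eq; first exact: porbit_id.
move=> k; rewrite emb_cycle_val => /imsetP[k' k'c ->].
by rewrite j_mono; apply: pcycle_least_min.
Qed.

Lemma emb_cycle_len c : pcycle_len (emb_cycle c) = pcycle_len c.
Proof. by rewrite /pcycle_len emb_cycle_val card_imset //; apply: j_inj. Qed.

Lemma emb_cycle_list c :
  pcycle_list (emb_cycle c) = map j (pcycle_list c) :> seq 'I_n.
Proof.
rewrite !pcycle_listE emb_cycle_len emb_cycle_least.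
elim: (pcycle_len c) (pcycle_least c) => //= d IH h.
by rewrite -j_s IH.
Qed.

Lemma emb_cycle_inj : injective emb_cycle.
Proof.
move=> c c' cc; rewrite -(pcycle_of_least c) -(pcycle_of_least c').
by congr pcycle_of; apply: j_inj; rewrite -!emb_cycle_least cc.
Qed.

Lemma prod_emb_cycle (C : comPzSemiRingType) (F : pcycle s -> C) :
  (forall c, pcycle_least c \notin codom j -> F c = 1) ->
  \prod_c F c = \prod_c F (emb_cycle c).
Proof.
move=> F1; rewrite (bigID (fun c => pcycle_least c \in codom j)) /=.
rewrite [X in _ * X]big1 // mulr1.
transitivity (\prod_(c in [set emb_cycle c | c in predT]) F c).
  apply: eq_bigl => c; apply/codomP/imsetP => [[h hc]|[c' _ ->]]; last first.
    by rewrite emb_cycle_least; exists (pcycle_least c').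
  exists (pcycle_of s0 h) => //; rewrite -(pcycle_of_least c) hc.
  apply/pcycle_ofP; rewrite porbit_sym porbit_emb imset_f //.
  by have := pcycle_least_in (pcycle_of s0 h).
rewrite big_imset /=; last by move=> c c' _ _; apply: emb_cycle_inj.
by apply: eq_bigl => c; rewrite inE.
Qed.

Variables (V : finType) (hv : V -> 'I_n).
Hypothesis hv_inj : injective hv.
Hypothesis hv_j : forall v, hv v \notin codom j.
Hypothesis a_hv : forall v w, a (hv v) != hv w.
Hypothesis hv_cover : forall h, h \notin codom j ->
  exists v, h = hv v \/ h = a (hv v).

Lemma codom_a h : (a h \in codom j) = (h \in codom j).
Proof.
apply/idP/idP => /codomP[k hk]; last by rewrite hk -j_a codom_f.
by rewrite -[h]aK hk -j_a codom_f.
Qed.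

Section Glue.
Variable X : finType.
Implicit Type (p : {ffun 'I_n0 -> X} * {ffun V -> X}).

Definition restr (i : {ffun 'I_n -> X}) : {ffun 'I_n0 -> X} := [ffun h => i (j h)].

(** A colouring compatible with [a] amounts to one of the embedded map and a free colour for each
    loop [{hv v, a (hv v)}]. The default [x] is never reached, by [hv_cover]. *)
Definition glue (x : X) p : {ffun 'I_n -> X} :=
  [ffun h => if [pick k | h == j k] is Some k then p.1 k
             else if [pick v | (h == hv v) || (h == a (hv v))] is Some v
             then p.2 v else x].

Lemma glue_j x p h : glue x p (j h) = p.1 h.
Proof.
rewrite ffunE; case: pickP => [k /eqP/j_inj->//|/(_ h)].
by rewrite eqxx.
Qed.

Lemma glue_hv x p v : glue x p (hv v) = p.2 v.
Proof.
rewrite ffunE; case: pickP => [k /eqP hk|_].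
  by have := hv_j v; rewrite hk codom_f.
case: pickP => [w /orP[/eqP/hv_inj->//|/eqP E]|/(_ v)]; last by rewrite eqxx.
by have := a_hv w v; rewrite E eqxx.
Qed.

Lemma glue_ahv x p v : glue x p (a (hv v)) = p.2 v.
Proof.
rewrite ffunE; case: pickP => [k /eqP hk|_].
  by have := hv_j v; rewrite -codom_a hk codom_f.
case: pickP => [w /orP[/eqP E|/eqP/perm_inj/hv_inj->//]|/(_ v)].
  by have := a_hv v w; rewrite E eqxx.
by rewrite eqxx orbT.
Qed.

Lemma sum_glue (x : X) (C : nmodType) (F : {ffun 'I_n0 -> X} -> C) :
  \sum_(i : {ffun 'I_n -> X} | compat a i) F (restr i) =
  (\sum_(i | compat a0 i) F i) *+ #|X| ^ #|V|.
Proof.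
pose split (i : {ffun 'I_n -> X}) := (restr i, [ffun v => i (hv v)]).
rewrite (reindex_onto (glue x) split) /= => [|i /compatP ai]; last first.
  apply/ffunP => h; have [/codomP[k ->]|/hv_cover[v [->|->]]] := boolP (h \in codom j).
  - by rewrite glue_j ffunE.
  - by rewrite glue_hv ffunE.
  - by rewrite glue_ahv ffunE ai.
have restrK p : restr (glue x p) = p.1 by apply/ffunP => h; rewrite ffunE glue_j.
transitivity (\sum_(p : {ffun 'I_n0 -> X} * {ffun V -> X} | compat a0 p.1 && true) F p.1).
  apply: eq_big => [p|p _]; last by rewrite restrK.
  have -> : split (glue x p) == p.
    apply/eqP; case: p => p1 p2; congr pair; first exact: restrK.
    by apply/ffunP => v; rewrite ffunE glue_hv.
  rewrite !andbT; apply/compatP/compatP => ap h.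
    by have := ap (j h); rewrite -j_a !glue_j.
  have [/codomP[k ->]|/hv_cover[v [->|->]]] := boolP (h \in codom j).
  - by rewrite -j_a !glue_j ap.
  - by rewrite glue_ahv glue_hv.
  - by rewrite aK glue_ahv glue_hv.
rewrite -(pair_big (compat a0) xpredT (fun i _ => F i)) /=.
rewrite -sumrMnl; apply: eq_bigr => i _.
by rewrite sumr_const card_ffun.
Qed.

End Glue.

Hypothesis s_hv : forall v, s (hv v) = a (hv v) /\ s (a (hv v)) = hv v.

(** The invariants with values in [bool] number 2 to the power of the number of components, so
    [sum_glue] with [X = bool] counts components just as it computes traces. *)
Lemma ncomp_emb : ncomp s a = (ncomp s0 a0 + #|V|)%N.
Proof.
apply/eqP; rewrite -(eqn_exp2l _ _ (isT : 1 < 2)%N) expnD -!card_invariants.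
have E (k : nat) (t b : 'S_k) :
    #|invariants t b| = (\sum_(i : {ffun 'I_k -> bool} | compat b i) compat t i)%N.
  rewrite /invariants -sum1dep_card.
  under eq_bigl do rewrite andbC.
  by rewrite big_mkcondr; apply: eq_bigr => i _; case: (compat t i).
have G : (\sum_(i : {ffun 'I_n -> bool} | compat a i) compat s0 (restr i) =
    (\sum_(i : {ffun 'I_n0 -> bool} | compat a0 i) compat s0 i) * 2 ^ #|V|)%N.
  have := sum_glue true (fun i => (compat s0 i : nat)).
  by rewrite card_bool -mulr_natr natn => H; exact: H.
rewrite !E -G; apply/eqP.
apply: eq_bigr => i /compatP ai; congr nat_of_bool.
apply/compatP/compatP => si h; first by rewrite !ffunE j_s si.
have [/codomP[k ->]|/hv_cover[v [->|->]]] := boolP (h \in codom j).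
- by have := si k; rewrite !ffunE j_s.
- by have [-> _] := s_hv v; rewrite ai.
- by have [_ ->] := s_hv v; rewrite ai.
Qed.
End Embedding.

(** * Traces of maps *)

Section Traces.
Variables (R : realType) (N : nat).

(* Evaluating tensors at sequences, with value 0 at a wrong length, avoids casts
   between the types of tuples of length deg v and l (label v). *)
Definition tensor_at (I : Type) (l : I -> nat) (A : tfamily R N l) (i : I)
    (s : seq 'I_N) : R[i] :=
  if (insub s : option ((l i).-tuple 'I_N)) is Some t then A i t else 0.

Definition matrix_at (M : 'M[R[i]]_N) (s : seq 'I_N) : R[i] :=
  if s is [:: x; y] then M x y else 0.

Lemma label_tensorE (I : Type) (l : I -> nat) (m : imap l) (A : tfamily R N l)
    (v : vertex m) t : label_tensor A v t = tensor_at A (label v) (tval t).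
Proof.
rewrite ffunE /tensor_at; case: insubP => [t' _ tt'|/negP[]].
  by congr (A _ _); apply: val_inj; apply: etrans (val_tcast _ _) (esym tt').
by rewrite size_tuple label_deg.
Qed.

Lemma mx_tensorE p (M : 'M[R[i]]_N) (t : p.-tuple 'I_N) :
  mx_tensor p M t = matrix_at M (tval t).
Proof. by rewrite ffunE. Qed.

Lemma tensor_at_adjoin (I : Type) (l : I -> nat) (A : tfamily R N l)
    (M : 'M[R[i]]_N) (o : option I) s :
  tensor_at (adjoin A M) o s = if o is Some i then tensor_at A i s else matrix_at M s.
Proof.
case: o => [i|] //; rewrite /tensor_at; case: insubP => [t _ <-|] /=.
  by rewrite mx_tensorE.
by move: s => [|x [|y [|z s]]].
Qed.

Lemma vertex_trace_compat (m : cmap) (T : forall v : vertex m, tensor R N (deg v))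
    (G : vertex m -> seq 'I_N -> R[i]) :
  (forall v t, T v t = G v (tval t)) ->
  vertex_trace T = N%:R ^- ncomponents m *
    \sum_(j : {ffun 'I_(nhalf m) -> 'I_N} | compat (eperm m) j)
      \prod_(v : vertex m) G v [seq j h | h <- bdry v].
Proof.
move=> TG; congr (_ * _); rewrite -sum_edge; apply: eq_bigr => i _.
apply: eq_bigr => v _; rewrite TG; congr (G v _).
rewrite /= -[in RHS](map_tnth_enum (bdry v)) -map_comp.
by apply: eq_map => k /=; rewrite ffunE.
Qed.

Lemma trace_compat (I : Type) (l : I -> nat) (m : imap l) (A : tfamily R N l) :
  trace m A = N%:R ^- ncomponents m *
    \sum_(j : {ffun 'I_(nhalf m) -> 'I_N} | compat (eperm m) j)
      \prod_(v : vertex m) tensor_at A (label v) [seq j h | h <- bdry v].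
Proof.
pose G (v : vertex m) s := tensor_at A (label v) s.
by rewrite /trace (vertex_trace_compat (G := G)) // => v t; apply: label_tensorE.
Qed.

End Traces.

Section ComplexExpectation.
Context d (T : measurableType d) (R : realType) (P : probability T R).

Lemma cexpectation_sum (J : finType) (Q : pred J) (c : J -> R[i]) (Y : J -> T -> R) :
  (forall k, bounded_rv (Y k)) ->
  cexpectation P (fun t => \sum_(k | Q k) c k * (Y k t)%:C%C) =
  \sum_(k | Q k) c k * (mean P (Y k))%:C%C.
Proof.
move=> bY.
have ReM (x : R[i]) (y : R) : complex.Re (x * y%:C%C) = complex.Re x * y.
  by case: x => a b /=; rewrite mulr0 subr0.
have ImM (x : R[i]) (y : R) : complex.Im (x * y%:C%C) = complex.Im x * y.
  by case: x => a b /=; rewrite mulr0 add0r.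
have ReS (F : J -> R[i]) : complex.Re (\sum_(k | Q k) F k) = \sum_(k | Q k) complex.Re (F k).
  by apply: (big_morph (@complex.Re R)) => // -[a b] [a' b'].
have ImS (F : J -> R[i]) : complex.Im (\sum_(k | Q k) F k) = \sum_(k | Q k) complex.Im (F k).
  by apply: (big_morph (@complex.Im R)) => // -[a b] [a' b'].
rewrite /cexpectation !expectation.unlock.
apply/eqP; rewrite eq_complex; apply/andP; split; apply/eqP; rewrite (ReS, ImS).
  under [RHS]eq_bigr do rewrite ReM.
  rewrite -mean_sum //; congr fine; apply: eq_integral => t _.
  by rewrite ReS; under eq_bigr do rewrite ReM.
under [RHS]eq_bigr do rewrite ImM.
rewrite -mean_sum //; congr fine; apply: eq_integral => t _.
by rewrite ImS; under eq_bigr do rewrite ImM.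
Qed.

End ComplexExpectation.

(** * Vertices of degree two *)

Section BivalentVertices.
Variable m : cmap.
Implicit Types (v w : vertex m) (e : 'I_2).

Lemma ord2P e : e = ord0 \/ e = ord_max.
Proof. by case: e => -[|[|//]] h; [left|right]; apply: val_inj. Qed.

Lemma bdry2 v : deg v = 2%N ->
  bdry v = [:: half_edge v ord0; half_edge v ord_max] :> seq 'I_(nhalf m).
Proof.
move=> d2; have : size (bdry v) = 2%N by rewrite size_tuple.
rewrite /half_edge.
by move: (tval (bdry v)) => [|x [|y [|]]].
Qed.

Lemma half_edge_in v e : deg v = 2%N -> half_edge v e \in val v.
Proof.
move=> d2; rewrite -mem_pcycle_list -/(bdry v) bdry2 // !inE.
by case: (ord2P e) => ->; rewrite eqxx ?orbT.
Qed.

Lemma half_edge_inj v w e e' : deg v = 2%N -> deg w = 2%N ->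
  half_edge v e = half_edge w e' -> v = w /\ e = e'.
Proof.
move=> d2 d2' vw; have vw' : v = w.
  rewrite -(pcycle_of_eq (half_edge_in e d2)) vw.
  exact: pcycle_of_eq (half_edge_in e' d2').
split=> //; apply/val_inj/eqP; move/eqP: vw; rewrite -vw'.
have s2 : size (bdry v) = 2%N by rewrite size_tuple.
by rewrite nth_uniq ?s2 // uniq_pcycle_list.
Qed.

Lemma vperm_half v e : deg v = 2%N ->
  vperm m (half_edge v e) = half_edge v (rev_ord e).
Proof.
move=> d2; have := pcycle_listE v.
rewrite -/(bdry v) bdry2 // -/(deg v) d2 /= => -[E0 E1].
case: (ord2P e) => ->.
  by rewrite (_ : rev_ord ord0 = ord_max) ?E1 ?E0 //; apply: val_inj.
rewrite (_ : rev_ord ord_max = ord0); last exact: val_inj.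
rewrite E1 E0; have : (vperm m ^+ 2)%g (pcycle_least v) = pcycle_least v.
  have := iter_porbit (vperm m) (pcycle_least v).
  by rewrite -pcycle_val -/(pcycle_len v) -/(deg v) d2 permX.
by rewrite expgS expg1 permM.
Qed.

End BivalentVertices.

Section FreeVertices.
Variables (I : finType) (l : I -> nat) (m : imap (adjl l)).

Definition free_vertices : {set vertex m} := [set v | label v == None].

Lemma deg_free (v : vertex m) : label v = None -> deg v = 2%N.
Proof. by move=> vN; rewrite label_deg vN. Qed.

End FreeVertices.

Lemma real_complex_natM (R : realType) (b : nat) (p : R) :
  (b%:R * p)%:C%C = b%:R * p%:C%C :> R[i].
Proof. by rewrite rmorphM rmorph_nat. Qed.

Lemma real_complex_natB (R : realType) (b c : nat) (p q : R) :
  (b%:R * p - c%:R * q)%:C%C = b%:R * p%:C%C - c%:R * q%:C%C :> R[i].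
Proof. by rewrite rmorphB !rmorphM !rmorph_nat. Qed.

(** * The mean trace of a map in terms of Haar moments *)

Section Instance.
Variables (R : realType) (d : nat -> measure_display)
  (T : forall N, measurableType (d N)) (P : forall N, probability (T N) R)
  (U : forall N, T N -> 'M[R]_N).
Hypothesis hU : forall N, (0 < N)%N -> haar_orthogonal (P N) (@U N).
Variables (I : finType) (l : I -> nat) (A0 : forall N, tfamily R N l).
Variable m : imap (adjl l).
Implicit Types (v w : vertex m) (K : {set vertex m}) (e : 'I_2).

Let n := nhalf m.
Let VU := free_vertices m.
Let half : vertex m -> 'I_2 -> 'I_n := @half_edge m.

(** It involves the vertices only, so a map and all its switches share it. *)
Definition fixed_weight N (i : {ffun 'I_n -> 'I_N}) : R[i] :=
  \prod_(v : vertex m) (if label v is Some k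
                        then tensor_at (A0 N) k [seq i h | h <- bdry v] else 1).

Definition end_indices N (i : {ffun 'I_n -> 'I_N}) e : {ffun vertex m -> 'I_N} :=
  [ffun v => i (half v e)].

Lemma end_indicesE N (i : {ffun 'I_n -> 'I_N}) e v : end_indices i e v = i (half v e).
Proof. exact: ffunE. Qed.

Definition free_moment N K (i : {ffun 'I_n -> 'I_N}) : R[i] :=
  (moment (P N) (@U N) K (end_indices i ord0) (end_indices i ord_max))%:C%C.

Lemma free_label v : v \in VU -> label v = None.
Proof. by rewrite inE => /eqP. Qed.

Lemma free_half_inj v w e e' : v \in VU -> w \in VU ->
  half v e = half w e' -> v = w /\ e = e'.
Proof. by move=> /free_label/deg_free vN /free_label/deg_free wN; apply: half_edge_inj. Qed.

Lemma fixed_weight_upd N v e (i : {ffun 'I_n -> 'I_N}) x : v \in VU ->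
  fixed_weight (upd i (half v e) x) = fixed_weight i.
Proof.
move=> vU; apply: eq_bigr => w _; case E: (label w) => [k|//]; congr tensor_at.
apply/eq_in_map => h; rewrite mem_pcycle_list => hw; rewrite updE ifN //.
apply: contra_eq_neq E => hE; move: hw; rewrite hE => hw.
have vN := free_label vU.
by rewrite -(pcycle_of_eq hw) (pcycle_of_eq (half_edge_in e (deg_free vN))) vN.
Qed.

Lemma end_indices_upd N v e (i : {ffun 'I_n -> 'I_N}) x : v \in VU ->
  {in VU, end_indices (upd i (half v e) x) e =1 upd (end_indices i e) v x}.
Proof.
move=> vU w wU; rewrite end_indicesE !updE (half_eq free_half_inj) // eqxx andbT.
by rewrite end_indicesE.
Qed.

Lemma end_indices_upd_neq N v e e' (i : {ffun 'I_n -> 'I_N}) x :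
  v \in VU -> e' != e ->
  {in VU, end_indices (upd i (half v e) x) e' =1 end_indices i e'}.
Proof.
move=> vU /negPf ee w wU.
by rewrite !end_indicesE updE (half_eq free_half_inj) // ee andbF.
Qed.

Lemma free_moment_upd0 N K v (i : {ffun 'I_n -> 'I_N}) x :
  K \subset VU -> v \in VU ->
  free_moment K (upd i (half v ord0) x) =
  (moment (P N) (@U N) K (upd (end_indices i ord0) v x) (end_indices i ord_max))%:C%C.
Proof.
move=> /fintype.subsetP KU vU; rewrite /free_moment.
have E0 := sub_in1 KU (end_indices_upd ord0 i x vU).
have E1 := sub_in1 KU (end_indices_upd_neq (e := ord0) (e' := ord_max) i x vU isT).
by rewrite (eq_moment (P N) (@U N) E0 E1).
Qed.

(** [moment_sym] turns the updated column index into a row index, so each relation below follows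
    from its version for rows. *)
Lemma free_moment_upd1 N K v (i : {ffun 'I_n -> 'I_N}) x :
  K \subset VU -> v \in VU ->
  free_moment K (upd i (half v ord_max) x) =
  (moment (P N) (@U N) K (upd (end_indices i ord_max) v x) (end_indices i ord0))%:C%C.
Proof.
have N0 : (0 < N)%N := leq_ltn_trans (leq0n x) (ltn_ord x).
move=> /fintype.subsetP KU vU; rewrite /free_moment.
have E0 := sub_in1 KU (end_indices_upd_neq (e := ord_max) (e' := ord0) i x vU isT).
have E1 := sub_in1 KU (end_indices_upd ord_max i x vU).
by rewrite (eq_moment (P N) (@U N) E0 E1) (moment_sym (hU N0)).
Qed.

Lemma free_moment_off N K v e (i : {ffun 'I_n -> 'I_N}) x :
  K \subset VU -> v \in VU -> v \notin K ->
  free_moment K (upd i (half v e) x) = free_moment K i.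
Proof.
move=> KU vU vK.
have off (a : {ffun vertex m -> 'I_N}) : {in K, upd a v x =1 a}.
  by move=> w wK; rewrite updE ifN //; apply: contraNneq vK => <-.
have refl (a : {ffun vertex m -> 'I_N}) : {in K, a =1 a} by [].
case: (ord2P e) => ->.
  rewrite (free_moment_upd0 i x KU vU) /free_moment.
  by rewrite (eq_moment (P N) (@U N) (off (end_indices i ord0)) (refl (end_indices i ord_max))).
have N0 : (0 < N)%N := leq_ltn_trans (leq0n x) (ltn_ord x).
rewrite (free_moment_upd1 i x KU vU) /free_moment.
rewrite (moment_sym (hU N0) K (end_indices i ord0) (end_indices i ord_max)).
by rewrite (eq_moment (P N) (@U N) (off (end_indices i ord_max)) (refl (end_indices i ord0))).
Qed.

Lemma free_moment_SD N K e (i : {ffun 'I_n -> 'I_N}) (x y : 'I_N) :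
  (0 < N)%N -> K \subset VU ->
  \sum_(v in K) ((i (half v e) == x)%:R * free_moment K (upd i (half v e) y)
                 - (i (half v e) == y)%:R * free_moment K (upd i (half v e) x)) = 0.
Proof.
move=> N0 KU; have vU v : v \in K -> v \in VU by apply: fintype.subsetP.
case: (ord2P e) => ->.
  transitivity ((\sum_(v in K) (((end_indices i ord0 v == x)%:R *
      moment (P N) (@U N) K (upd (end_indices i ord0) v y) (end_indices i ord_max)
    - (end_indices i ord0 v == y)%:R *
      moment (P N) (@U N) K (upd (end_indices i ord0) v x) (end_indices i ord_max))))%:C)%C.
    rewrite rmorph_sum; apply: eq_bigr => v vK; rewrite !(free_moment_upd0 _ _ KU (vU v vK)).
    by rewrite /= !end_indicesE real_complex_natB.
  by rewrite moment_SD ?rmorph0 //; apply: hU.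
transitivity ((\sum_(v in K) (((end_indices i ord_max v == x)%:R *
    moment (P N) (@U N) K (upd (end_indices i ord_max) v y) (end_indices i ord0)
  - (end_indices i ord_max v == y)%:R *
    moment (P N) (@U N) K (upd (end_indices i ord_max) v x) (end_indices i ord0))))%:C)%C.
  rewrite rmorph_sum; apply: eq_bigr => v vK; rewrite !(free_moment_upd1 _ _ KU (vU v vK)).
  by rewrite /= !end_indicesE real_complex_natB.
by rewrite moment_SD ?rmorph0 //; apply: hU.
Qed.

Lemma free_moment_orth N K v w e (i : {ffun 'I_n -> 'I_N}) :
  (0 < N)%N -> K \subset VU -> v \in K -> w \in K -> v != w ->
  \sum_x free_moment K (upd (upd i (half v e) x) (half w e) x) =
    (i (half v (rev_ord e)) == i (half w (rev_ord e)))%:R *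
    free_moment (K :\ v :\ w) i.
Proof.
move=> N0 KU vK wK vw; have sKU := fintype.subsetP KU.
have [vU wU] := (sKU _ vK, sKU _ wK).
have r0 : rev_ord ord0 = ord_max :> 'I_2 by apply: val_inj.
have r1 : rev_ord ord_max = ord0 :> 'I_2 by apply: val_inj.
have upd_in (a b : {ffun vertex m -> 'I_N}) x : {in VU, a =1 b} ->
    {in K, upd a w x =1 upd b w x}.
  by move=> ab z /sKU zU; rewrite !updE ab.
have orth := moment_orth (hU N0) _ _ vK wK vw.
case: (ord2P e) => ->; rewrite ?r0 ?r1.
  rewrite -!end_indicesE [in RHS]/free_moment -real_complex_natM -orth rmorph_sum.
  apply: eq_bigr => x _; rewrite (free_moment_upd0 _ _ KU wU) /=.
  have E0 := upd_in _ _ x (end_indices_upd ord0 i x vU).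
  have E1 := sub_in1 sKU (end_indices_upd_neq (e := ord0) (e' := ord_max) i x vU isT).
  exact: (congr1 (real_complex R) (eq_moment (P N) (@U N) E0 E1)).
have sym := moment_sym (hU N0) _ (end_indices i ord0) (end_indices i ord_max).
rewrite -!end_indicesE [in RHS]/free_moment sym -real_complex_natM -orth rmorph_sum.
apply: eq_bigr => x _; rewrite (free_moment_upd1 _ _ KU wU) /=.
have E0 := upd_in _ _ x (end_indices_upd ord_max i x vU).
have E1 := sub_in1 sKU (end_indices_upd_neq (e := ord_max) (e' := ord0) i x vU isT).
exact: (congr1 (real_complex R) (eq_moment (P N) (@U N) E0 E1)).
Qed.

Lemma prod_label N (M : 'M[R]_N) (i : {ffun 'I_n -> 'I_N}) :
  \prod_(v : vertex m)
    tensor_at (with_orthogonal (A0 N) M) (label v) [seq i h | h <- bdry v] =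
  fixed_weight i *
  (\prod_(v in VU) M (end_indices i ord0 v) (end_indices i ord_max v))%:C%C.
Proof.
rewrite rmorph_prod /fixed_weight [X in _ * X]big_mkcond -big_split /=.
apply: eq_bigr => v _; rewrite tensor_at_adjoin inE.
case E: (label v) => [k|] /=; first by rewrite mulr1.
by rewrite mul1r !end_indicesE (bdry2 (deg_free E)) /= mxE.
Qed.

(** The permutation [a] is arbitrary because a switched map has the same half-edges, vertices and
    labels as [m]. *)
Lemma cexpectation_compat N (a : 'S_n) (c : R[i]) : (0 < N)%N ->
  cexpectation (P N) (fun t => c *
    \sum_(i : {ffun 'I_n -> 'I_N} | compat a i) \prod_(v : vertex m)
      tensor_at (with_orthogonal (A0 N) (U t)) (label v) [seq i h | h <- bdry v]) =
  c * netval (@fixed_weight N) (@free_moment N) a VU.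
Proof.
move=> N0; rewrite /netval mulr_sumr.
under [RHS]eq_bigr do rewrite mulrA.
rewrite -cexpectation_sum => [|i]; last exact: (bounded_rv_monom (hU N0)).
congr cexpectation; apply/funext => t; rewrite mulr_sumr; apply: eq_bigr => i _.
by rewrite prod_label mulrA.
Qed.

End Instance.

(** * Removing loops, and the base case of the bound *)

Section Restriction.
Variables (n : nat) (A : {set 'I_n}).

Lemma enum_val_mono : {mono (@enum_val _ (mem A)) : h k / (h <= k)%N}.
Proof.
have srt : sorted ltn (map (@nat_of_ord n) (enum A)).
  rewrite sorted_map /enum_mem -enumT; apply: sorted_filter.
    by move=> x y z /=; apply: ltn_trans.
  by rewrite -sorted_map val_enum_ord iota_ltn_sorted.
have lt (h k : 'I_#|A|) : (h < k)%N -> (enum_val h < enum_val k)%N.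
  have valE (k' : 'I_#|A|) :
      enum_val k' = nth 0%N (map (@nat_of_ord n) (enum A)) k' :> nat.
    by rewrite (nth_map (enum_val k')) -?cardE // -enum_val_nth.
  move=> hk; rewrite !valE.
  by apply: (sorted_ltn_nth ltn_trans 0%N srt) => //; rewrite inE size_map -cardE.
move=> h k; case: (ltngtP h k) => [/lt/ltnW->//|/lt|/val_inj->].
  by move=> kh; apply/negbTE; rewrite -ltnNge.
by rewrite !leqnn.
Qed.

Lemma restrict_perm (s : 'S_n) : (forall h, (s h \in A) = (h \in A)) ->
  exists s0 : 'S_#|A|, forall h, enum_val (s0 h) = s (enum_val h).
Proof.
move=> sA; pose f (h : 'I_#|A|) := enum_rank_in (enum_valP h) (s (enum_val h)).
have fE h : enum_val (f h) = s (enum_val h).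
  by rewrite enum_rankK_in // sA enum_valP.
have f_inj : injective f.
  by move=> h k hk; apply/enum_val_inj/(@perm_inj _ s); rewrite -!fE hk.
by exists (perm f_inj) => h; rewrite permE.
Qed.

Lemma codom_enum_val h : (h \in codom (@enum_val _ (mem A))) = (h \in A).
Proof.
apply/codomP/idP => [[k ->]|hA]; first exact: enum_valP.
by exists (enum_rank_in hA h); rewrite enum_rankK_in.
Qed.

End Restriction.

Section RestrictMap.
Variables (I : finType) (l : I -> nat) (m : imap (adjl l)) (a : 'S_(nhalf m)).
Hypotheses (aK : involutive a) (a_fpf : forall h, a h != h).
Hypothesis a_free : forall v : vertex m, label v = None ->
  forall e, a (half_edge v e) = half_edge v (rev_ord e).

Lemma free_half h : label (pcycle_of (vperm m) h) = None ->
  exists e, h = half_edge (pcycle_of (vperm m) h) e.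
Proof.
move=> hN; have : h \in (bdry (pcycle_of (vperm m) h) : seq _).
  by rewrite mem_pcycle_list porbit_id.
by rewrite (bdry2 (deg_free hN)) !inE => /orP[]/eqP E; [exists ord0|exists ord_max].
Qed.

Lemma label_half (v : vertex m) e : label v = None ->
  label (pcycle_of (vperm m) (half_edge v e)) = None.
Proof. by move=> vN; rewrite (pcycle_of_eq (half_edge_in e (deg_free vN))). Qed.

(** The vertices labelled [None] are loops for [a], so the other half-edges are stable under both
    permutations. They form a map labelled in [I] without boundary edges, to which (A1) applies. *)
Lemma restrict_imap :
  exists (m0 : imap l) (j : 'I_(nhalf m0) -> 'I_(nhalf m)),
    [/\ nboundary m0 = 0%N, {mono j : h k / (h <= k)%N},
        forall h, j (vperm m0 h) = vperm m (j h),
        forall h, j (eperm m0 h) = a (j h) &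
        (forall h, (h \in codom j) = (label (pcycle_of (vperm m) h) != None)) /\
        (forall v0 : vertex m0,
           label (pcycle_of (vperm m) (j (pcycle_least v0))) = Some (label v0))].
Proof.
pose A := [set h | label (pcycle_of (vperm m) h) != None].
have sA h : (vperm m h \in A) = (h \in A) by rewrite !inE pcycle_of_s.
have aA h : (a h \in A) = (h \in A).
  have out k : k \notin A -> a k \notin A.
    rewrite !inE !negbK => /eqP kN; have [e ->] := free_half kN.
    by rewrite a_free // label_half.
  by apply/idP/idP; apply: contraTT => /out; rewrite ?aK.
have [s0 s0E] := restrict_perm sA; have [a0 a0E] := restrict_perm aA.
have a0K : involutive a0 by move=> h; apply: enum_val_inj; rewrite !a0E aK.
pose m0 := @CMap #|A| s0 a0 a0K.
pose j : 'I_#|A| -> 'I_(nhalf m) := @enum_val _ (mem A).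
have jm : {mono j : h k / (h <= k)%N} := @enum_val_mono _ A.
have lab (v0 : vertex m0) :
    {k | label (pcycle_of (vperm m) (j (pcycle_least v0))) = Some k}.
  have : j (pcycle_least v0) \in A := enum_valP _.
  by rewrite inE; case: (label _) => // k _; exists k.
have deg0 (v0 : vertex m0) : deg v0 = l (sval (lab v0)).
  case: (lab v0) => k /= kE; have := label_deg (pcycle_of (vperm m) (j (pcycle_least v0))).
  by rewrite kE /= => <-; apply: esym (emb_cycle_len jm s0E v0).
exists (@IMap I l m0 _ deg0), j; split=> //.
- apply: eq_card0 => h.
  by rewrite !inE /= -(inj_eq enum_val_inj) a0E (negPf (a_fpf _)).
- by split=> [h|v0] /=; [rewrite codom_enum_val inE | apply: (svalP (lab v0))].
Qed.

End RestrictMap.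

Section DeadBound.
Variables (R : realType) (d : nat -> measure_display)
  (T : forall N, measurableType (d N)) (P : forall N, probability (T N) R)
  (U : forall N, T N -> 'M[R]_N).
Variables (I : finType) (l : I -> nat) (A0 : forall N, tfamily R N l).
Hypothesis A1 : forall n : imap l, nboundary n = 0%N ->
  exists C : R, forall N, (0 < N)%N -> `|trace n (A0 N)| <= C%:C%C.
Variable m : imap (adjl l).

Lemma free_moment0 N (i : {ffun 'I_(nhalf m) -> 'I_N}) :
  free_moment P U finset.set0 i = 1.
Proof.
rewrite /free_moment /moment -[RHS]/((1 : R)%:C)%C; congr (_%:C)%C.
by rewrite -[RHS](mean_cst (P N)); congr mean; apply/funext => t; rewrite big_set0.
Qed.

Lemma normrE (x : R[i]) : `|x| = (normc x)%:C%C.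
Proof. by case: x => a b; rewrite normc_def. Qed.

Lemma normcE_real (x : R[i]) (C : R) : (`|x| <= C%:C%C) = (normc x <= C).
Proof. by rewrite normrE lecR. Qed.

Lemma normc_natX N k : normc ((N%:R : R[i]) ^+ k) = (N%:R : R) ^+ k.
Proof.
apply: complexI; rewrite -normrE normrX normr_nat.
by rewrite rmorphXn /= rmorph_nat.
Qed.

(** Each loop gives a factor [N] to the sum and one component to the exponent; after normalisation
    only the trace of the restricted map is left. *)
Lemma dead_bound (a : 'S_(nhalf m)) :
  good_perm (@half_edge m) (free_vertices m) finset.set0 a ->
  exists B : R, forall N, (0 < N)%N ->
    normc (netval (@fixed_weight R I l A0 m N) (@free_moment R d T P U I l m N) a finset.set0)
      <= B * N%:R ^+ ncomp (vperm m) a.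
Proof.
case/good_permP=> aK af ad.
have a_free v : label v = None ->
    forall e, a (half_edge v e) = half_edge v (rev_ord e).
  by move=> vN; apply: ad; rewrite !inE ?vN.
have [m0 [j [nb jm js ja [jc jl]]]] := restrict_imap aK af a_free.
have [B HB] := A1 nb; exists B => N N0; have x0 : 'I_N := Ordinal N0.
pose VV := {v : vertex m | v \in free_vertices m}.
pose hv (v : VV) := half_edge (val v) ord0.
have vN (v : VV) : label (val v) = None by case: v => v /=; rewrite inE => /eqP.
have hv_inj : injective hv.
  by move=> v w /(half_edge_inj (deg_free (vN v)) (deg_free (vN w)))[vw _]; apply: val_inj.
have hv_j v : hv v \notin codom j by rewrite jc label_half.
have a_hv v w : a (hv v) != hv w.
  rewrite a_free //; apply/eqP => /(half_edge_inj (deg_free (vN v)) (deg_free (vN w)))[_].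
  by move/eqP.
have cover h : h \notin codom j -> exists v, h = hv v \/ h = a (hv v).
  rewrite jc negbK => /eqP hN; have [e hE] := free_half hN.
  move: hN hE; move: (pcycle_of _ h) => v vfree ->.
  have vU : v \in free_vertices m by rewrite inE vfree.
  exists (exist (fun v => v \in free_vertices m) v vU); rewrite a_free //.
  case: (ord2P e) => ->; [left|right] => //.
have s_hv v : vperm m (hv v) = a (hv v) /\ vperm m (a (hv v)) = hv v.
  by have dv := deg_free (vN v); rewrite a_free // !vperm_half // rev_ordK.
pose F (i : {ffun 'I_(nhalf m0) -> 'I_N}) :=
  \prod_(v0 : vertex m0) tensor_at (A0 N) (label v0) [seq i h | h <- bdry v0].
have WE i : fixed_weight A0 i = F (restr j i).
  rewrite /fixed_weight (prod_emb_cycle jm js) => [|c]; last first.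
    by rewrite jc negbK pcycle_of_least => /eqP->.
  apply: eq_bigr => v0 _; rewrite (jl v0); congr tensor_at.
  have bE : bdry (emb_cycle (vperm m) j v0 : vertex m) = map j (bdry v0) :> seq _.
    exact: emb_cycle_list jm js v0.
  rewrite bE -map_comp; by apply: eq_map => h /=; rewrite ffunE.
have nE := ncomp_emb jm js ja aK hv_inj hv_j a_hv cover s_hv.
have sE := sum_glue jm ja aK hv_inj hv_j a_hv cover x0 F.
have -> : netval (@fixed_weight R I l A0 m N) (@free_moment R d T P U I l m N)
    a finset.set0 = trace m0 (A0 N) * N%:R ^+ ncomp (vperm m) a.
  rewrite /netval; under eq_bigr do rewrite free_moment0 mulr1 WE.
  rewrite sE trace_compat nE exprD [ncomponents _]/(ncomp (vperm m0) (eperm m0)).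
  rewrite -[LHS]mulr_natr natrX card_ord [X in _ = X * _]mulrC mulrA.
  by rewrite -[X in _ = X * _]mulrA mulVf ?mulr1 // expf_neq0 // pnatr_eq0 -lt0n.
rewrite ComplexField.Normc.normcM normc_natX ler_wpM2r ?exprn_ge0 //.
by rewrite -normcE_real HB.
Qed.

End DeadBound.

(** * Adjoining an identity loop *)

Section LoopUnion.
Variables (I : finType) (l : I -> nat) (m : imap l).

Let un := imap_union (some_label m) (identity_loop l).
Let n := nhalf m.
Let j : 'I_n -> 'I_(n + 2) := @lshift n 2.
Let hv (_ : unit) : 'I_(n + 2) := rshift n (ord0 : 'I_2).

Let j_mono : {mono j : h k / (h <= k)%N}. Proof. by []. Qed.

Lemma union_vperm h : j (vperm m h) = vperm un (j h).
Proof. by rewrite /= permE sum_funl. Qed.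

Lemma union_eperm h : j (eperm m h) = eperm un (j h).
Proof. by rewrite /= permE sum_funl. Qed.

Let eperm_hv : eperm un (hv tt) = rshift n (ord_max : 'I_2).
Proof. by rewrite /= permE sum_funr /= tpermL. Qed.

Let hv_inj : injective hv. Proof. by do 2!case. Qed.

Let codom_j h : (h \in codom j) = (h < n)%N.
Proof.
apply/codomP/idP => [[k ->]|hn]; first exact: (ltn_ord k).
by exists (Ordinal hn); apply: val_inj.
Qed.

Let hv_j v : hv v \notin codom j.
Proof. by rewrite codom_j /= addn0 ltnn. Qed.

Let a_hv v w : eperm un (hv v) != hv w.
Proof. by case: v; rewrite eperm_hv -val_eqE /= eqn_add2l. Qed.

Let cover h : h \notin codom j -> exists v, h = hv v \/ h = eperm un (hv v).
Proof.
case: (split_ordP h) => k ->; first by rewrite codom_j /= ltn_ord.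
move=> _; exists tt; rewrite eperm_hv.
by case: (ord2P k) => ->; [left|right].
Qed.

Let v_hv v : vperm un (hv v) = eperm un (hv v) /\ vperm un (eperm un (hv v)) = hv v.
Proof. by case: v; rewrite eperm_hv /= !permE !sum_funr /= tpermL tpermR. Qed.

Lemma ncomponents_union : ncomponents un = (ncomponents m).+1.
Proof.
have := ncomp_emb j_mono union_vperm union_eperm (@epermK un) hv_inj hv_j a_hv cover v_hv.
by rewrite card_unit addn1.
Qed.

Definition union_vertex : vertex m -> vertex un := emb_cycle (vperm un) j.

Lemma bdry_union (v : vertex m) : bdry (union_vertex v) = map j (bdry v) :> seq _.
Proof. exact: emb_cycle_list j_mono union_vperm v. Qed.

Lemma union_vertex_inj : injective union_vertex.
Proof. exact: emb_cycle_inj j_mono union_vperm. Qed.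

Lemma label_union (v : vertex m) : label (union_vertex v) = Some (label v).
Proof.
rewrite /= /union_label.
have -> : pcycle_least (union_vertex v) = j (pcycle_least v).
  exact: emb_cycle_least j_mono union_vperm v.
by rewrite (unsplitK (inl _)) /= pcycle_of_least.
Qed.

Lemma label_union_loop (c : vertex un) : pcycle_least c \notin codom j ->
  label c = None.
Proof.
rewrite /= /union_label; case: (split_ordP (pcycle_least c)) => k ->.
  by rewrite codom_j /= ltn_ord.
by [].
Qed.

(** The free colour of the loop gives a factor [N], which its additional component cancels in the
    normalisation. *)
Lemma trace_union (R : realType) N (B : tfamily R N l) : (0 < N)%N ->
  trace un (with_identity B) = trace m B.
Proof.
move=> N0; have x0 : 'I_N := Ordinal N0.
pose F (i : {ffun 'I_n -> 'I_N}) :=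
  \prod_(v : vertex m) tensor_at B (label v) [seq i h | h <- bdry v].
have nz : (N%:R : R[i]) != 0 by rewrite pnatr_eq0 -lt0n.
rewrite !trace_compat ncomponents_union exprS invfM -mulrA mulrCA; congr (_ * _).
apply: (mulfI nz); rewrite mulrA mulfV // mul1r.
have := sum_glue j_mono union_eperm (@epermK un) hv_inj hv_j a_hv cover x0 F.
rewrite card_unit expn1 card_ord -[RHS]mulr_natl => <-.
apply: eq_bigr => i /compatP ai.
rewrite (prod_emb_cycle j_mono union_vperm) => [|c cN].
  apply: eq_bigr => v _; rewrite -/(union_vertex v) bdry_union label_union.
  rewrite tensor_at_adjoin -map_comp; congr tensor_at.
  by apply: eq_map => h /=; rewrite ffunE.
have cL := label_union_loop cN; have c2 := deg_free cL.
rewrite cL tensor_at_adjoin bdry2 //= mxE.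
(* The loop edge gives both half-edges of [c] the same colour, so a diagonal entry of the identity
   matrix is read. *)
suff -> : half_edge (m := un) c ord_max = eperm un (half_edge (m := un) c ord0) by rewrite ai eqxx.
have -> : ord_max = rev_ord ord0 :> 'I_2 by apply: val_inj.
rewrite -vperm_half //; have : half_edge (m := un) c ord0 \notin codom j.
  apply: contra cN => /codomP[k hk]; rewrite -(pcycle_of_eq (half_edge_in ord0 c2)) hk.
  have := pcycle_least_in (pcycle_of (vperm un) (j k)).
  by rewrite /= (porbit_emb union_vperm) => /imsetP[k' _ ->]; apply: codom_f.
move=> /cover[v [->|->]]; first by have [] := v_hv v.
by have [_ ->] := v_hv v; rewrite epermK.
Qed.

End LoopUnion.

(** * Replacing two joined orthogonal matrices by identities *)

Section OrthogonalPair.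
Variables (C : numFieldType) (D X : finType) (h1 h2 k1 k2 : D).
Hypotheses (h12 : h1 != h2) (k1h1 : k1 != h1) (k1h2 : k1 != h2)
  (k2h1 : k2 != h1) (k2h2 : k2 != h2).

(** The value does not depend on [M] beyond the orthogonality of its columns, a relation that the
    identity matrix satisfies too. *)
Lemma sum_orthogonal_pair (Q : {ffun D -> X} -> C) (M : X -> X -> C) :
  (forall b c, \sum_x M x b * M x c = (b == c)%:R) ->
  (forall i x, Q (upd i h1 x) = Q i) -> (forall i x, Q (upd i h2 x) = Q i) ->
  (\sum_(i : {ffun D -> X}) (i h1 == i h2)%:R * (Q i * (M (i h1) (i k1) * M (i h2) (i k2))))
    *+ #|X| *+ #|X| =
  \sum_(i : {ffun D -> X}) (i k1 == i k2)%:R * Q i.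
Proof.
move=> MM Q1 Q2; rewrite -(sum_upd _ h2) -(sum_upd _ h1); apply: eq_bigr => i _.
rewrite -MM mulr_suml; apply: eq_bigr => x _.
rewrite mulrC -(sum_delta x (fun y => Q i * (M x (i k1) * M y (i k2)))).
apply: eq_bigr => y _; rewrite !updE (negPf h12) !eqxx (negPf k1h1) (negPf k1h2).
by rewrite (negPf k2h1) (negPf k2h2) Q2 Q1 [y == x]eq_sym.
Qed.

End OrthogonalPair.

Section ReplaceByIdentity.
Variables (R : realType) (N : nat) (I : finType) (l : I -> nat).
Variables (A : tfamily R N l) (O : 'M[R]_N).
Hypothesis oO : orthogonal_mx O.
Variables (m : imap (adjl (adjl l))) (u v : vertex m) (e : 'I_2).
Hypotheses (uv : u != v) (uL : label u = Some None) (vL : label v = Some None).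
Hypothesis auv : eperm m (half_edge u e) = half_edge v e.
Hypothesis N0 : (0 < N)%N.
Let B := with_identity (with_orthogonal A O).

Lemma trace_replace_identity (p : pred (vertex m)) :
  (forall x, p x = (x == u) || (x == v)) ->
  trace m B = vertex_trace (fun x : vertex m =>
    if p x then mx_tensor _ 1%:M else label_tensor B x).
Proof.
move=> pE; rewrite trace_compat.
pose G (x : vertex m) s := if p x then matrix_at 1%:M s else tensor_at B (label x) s.
rewrite (vertex_trace_compat (G := G)) => [|x t]; last first.
  by rewrite /G; case: (p x); rewrite (mx_tensorE, label_tensorE).
congr (_ * _); have [du dv] : deg u = 2%N /\ deg v = 2%N by rewrite !label_deg uL vL.
pose h1 := half_edge u e; pose h2 := half_edge v e.
pose k1 := half_edge u (rev_ord e); pose k2 := half_edge v (rev_ord e).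
pose rest (i : {ffun 'I_(nhalf m) -> 'I_N}) :=
  \prod_(x : vertex m | (x != u) && (x != v)) tensor_at B (label x) [seq i h | h <- bdry x].
pose Q i := (compat_off (eperm m) [:: h1; h2] i)%:R * rest i.
(* The contracted index, that of the half-edge numbered [e], is made the first argument; hence both
   [O^T *m O] and [O *m O^T] occur below, according to [e]. *)
pose val (M : 'M[R[i]]_N) x y := if e == ord0 then M x y else M y x.
have split2 (H : vertex m -> R[i]) :
    \prod_x H x = H u * H v * \prod_(x | (x != u) && (x != v)) H x.
  by rewrite (bigD1 u) //= (bigD1 v) 1?eq_sym //= mulrA.
have matE (M : 'M[R[i]]_N) (i : {ffun 'I_(nhalf m) -> 'I_N}) x : deg x = 2%N ->
    matrix_at M [seq i h | h <- bdry x] =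
    val M (i (half_edge x e)) (i (half_edge x (rev_ord e))).
  move=> dx; rewrite bdry2 // /val.
  have r0 : rev_ord ord0 = ord_max :> 'I_2 by apply: val_inj.
  have r1 : rev_ord ord_max = ord0 :> 'I_2 by apply: val_inj.
  by case: (ord2P e) => ->; rewrite ?r0 ?r1.
have sumE (H : vertex m -> seq 'I_N -> R[i]) (M : 'M[R[i]]_N) :
    (forall s, H u s = matrix_at M s) -> (forall s, H v s = matrix_at M s) ->
    (forall x s, x != u -> x != v -> H x s = tensor_at B (label x) s) ->
    \sum_(i : {ffun 'I_(nhalf m) -> 'I_N} | compat (eperm m) i)
      \prod_(x : vertex m) H x [seq i h | h <- bdry x] =
    \sum_(i : {ffun 'I_(nhalf m) -> 'I_N}) (i h1 == i h2)%:R *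
      (Q i * (val M (i h1) (i k1) * val M (i h2) (i k2))).
  move=> Hu Hv Hx; rewrite big_mkcond; apply: eq_bigr => i _.
  rewrite compatE (compat_off_split _ _ h1 (@epermK m)) /= auv -/h2 split2.
  have -> : \prod_(x | (x != u) && (x != v)) H x [seq i h | h <- bdry x] = rest i.
    by apply: eq_bigr => x /andP[xu xv]; exact: Hx x _ xu xv.
  rewrite Hu Hv !matE // /Q.
  case: (i h1 == i h2); rewrite /= ?mulr0n ?mul0r // mul1r.
  by case: (compat_off _ _ _); rewrite ?mulr0n ?mul0r // mul1r mulrC.
pose Oc := map_mx (real_complex R) O.
rewrite (sumE (fun x => tensor_at B (label x)) Oc); first last.
- by [].
- by move=> s; rewrite vL /B tensor_at_adjoin tensor_at_adjoin.
- by move=> s; rewrite uL /B tensor_at_adjoin tensor_at_adjoin.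
rewrite (sumE G 1%:M); first last.
- by move=> x s xu xv; rewrite /G pE (negPf xu) (negPf xv).
- by move=> s; rewrite /G pE eqxx orbT.
- by move=> s; rewrite /G pE eqxx.
have h12 : h1 != h2 by apply/eqP => /(half_edge_inj du dv)[/eqP]; rewrite (negPf uv).
have kh x y z w : deg x = 2%N -> deg y = 2%N -> (z == w) = false ->
    half_edge x z != half_edge y w.
  by move=> dx dy zw; apply/eqP => /(half_edge_inj dx dy)[_ /eqP]; rewrite zw.
have re : (rev_ord e == e) = false by apply: rev_ord2_neq.
have stab k : k \in [:: h1; h2] -> eperm m k \in [:: h1; h2].
  rewrite !inE => /orP[]/eqP->; first by rewrite auv eqxx orbT.
  by rewrite /h2 -auv epermK eqxx.
have Qupd x (i : {ffun 'I_(nhalf m) -> 'I_N}) y : x \in [:: u; v] ->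
    Q (upd i (half_edge x e) y) = Q i.
  move=> xuv; have dx : deg x = 2%N by move: xuv; rewrite !inE => /orP[]/eqP->.
  rewrite /Q compat_off_upd //; last 2 first.
  - exact: epermK.
  - by move: xuv; rewrite !inE => /orP[]/eqP->; rewrite eqxx ?orbT.
  congr (_ * _); apply: eq_bigr => z /andP[zu zv]; congr tensor_at.
  apply/eq_in_map => h; rewrite mem_pcycle_list => hz; rewrite updE ifN //.
  apply/eqP => hE; have zx : z = x.
    by rewrite -(pcycle_of_eq hz) hE (pcycle_of_eq (half_edge_in e dx)).
  by move: xuv; rewrite -zx !inE (negPf zu) (negPf zv).
have OO : O^T *m O = 1%:M by apply: mulmx1C.
have orthO b c : \sum_x val Oc x b * val Oc x c = (b == c)%:R.
  have -> : (b == c)%:R = ((b == c)%:R : R)%:C%C by rewrite rmorph_nat.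
  rewrite /val; case: (e == ord0).
    have /matrixP/(_ b c) := OO; rewrite !mxE => <-.
    by rewrite rmorph_sum; apply: eq_bigr => x _; rewrite !mxE rmorphM.
  have /matrixP/(_ b c) := oO; rewrite !mxE => <-.
  by rewrite rmorph_sum; apply: eq_bigr => x _; rewrite !mxE rmorphM.
have orth1 b c : \sum_x val (1%:M : 'M[R[i]]_N) x b * val 1%:M x c = (b == c)%:R.
  rewrite -(sum_delta b (fun x => (x == c)%:R)); apply: eq_bigr => x _.
  by rewrite /val !mxE; case: (e == ord0); rewrite // ![_ == x]eq_sym.
have card0 : (0 < #|'I_N|)%N by rewrite card_ord.
(* Multiplied by [N ^ 2], the two sums are instances of [sum_orthogonal_pair] with the same right
   side. *)
apply: (pmulrnI card0); apply: (pmulrnI card0) => /=.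
have [Qu Qv] : (forall i x, Q (upd i h1 x) = Q i) /\ (forall i x, Q (upd i h2 x) = Q i).
  by split=> i x; apply: Qupd; rewrite !inE eqxx ?orbT.
by rewrite !sum_orthogonal_pair //; apply: kh.
Qed.

End ReplaceByIdentity.

(** * Excluded switches and the asymptotic relation *)

Lemma trace_some_label (R : realType) (I : Type) (l : I -> nat) (m : imap l) N
    (B : tfamily R N l) : trace (some_label m) (with_identity B) = trace m B.
Proof.
by rewrite !trace_compat.
Qed.

Lemma same_vertex_inj (m m' : cmap) (x : vertex m) (y z : vertex m') :
  same_vertex x y -> same_vertex x z -> y = z.
Proof.
move=> /eqP xy /eqP; rewrite xy => /(inj_map (@ord_inj _)) yz.
rewrite -(pcycle_of_least z); apply/esym/pcycle_of_eq.
by rewrite -mem_pcycle_list -/(bdry y) yz mem_pcycle_list pcycle_least_in.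
Qed.

Lemma same_vertex_refl (m : cmap) (x : vertex m) : same_vertex x x.
Proof. exact: eqxx. Qed.

Lemma same_vertexE (m m' : cmap) (x : vertex m) (y z : vertex m') :
  same_vertex x y -> same_vertex x z = (z == y).
Proof.
by move=> xy; apply/idP/eqP => [xz|->//]; apply: same_vertex_inj xz xy.
Qed.

(** The disjunction covers the switches left out of the two sums of the theorem: vertices in another
    component, where a switch cannot separate anything, and switches whose number of components
    differs from the maximal value allowed by [ncomp_switch]. *)
Lemma ncomp_le_switch n (s a : 'S_n) f x : involutive a -> (forall h, a h != h) ->
  ~~ connect (adj s a) f x || (ncomp s (switch_perm a f x) != (ncomp s a).+1) ->
  (ncomp s (switch_perm a f x) <= ncomp s a)%N.
Proof.
move=> aK af /orP[nc|neq].
  apply: ncomp_switch_disconnected => //.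
    by apply: contraNneq nc => ->; apply: connect0.
  by apply: contraNneq nc => <-; apply/connect1/adj_a.
by have := ncomp_switch s f x aK af; rewrite leq_eqVlt (negPf neq).
Qed.

Lemma mconnect_half (m : cmap) (u v : vertex m) h k :
  h \in val u -> k \in val v ->
  mconnect u v = connect (adj (vperm m) (eperm m)) h k.
Proof.
have root (w : vertex m) x : x \in val w ->
    connect (adj (vperm m) (eperm m)) (pcycle_least w) x.
  by rewrite pcycle_val => xw; apply/connect1/orP; left.
move=> /root hu /root kv; rewrite /mconnect.
rewrite -[madj (m := m)]/(adj (vperm m) (eperm m)).
have sym := adj_sym (vperm m) (eperm m).
by rewrite (same_connect sym hu) (same_connect_r sym kv).
Qed.

Section Expectations.
Variables (R : realType) (d : nat -> measure_display)
  (T : forall N, measurableType (d N)) (P : forall N, probability (T N) R)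
  (U : forall N, T N -> 'M[R]_N).
Hypothesis hU : forall N, (0 < N)%N -> haar_orthogonal (P N) (@U N).
Variables (I : finType) (l : I -> nat) (A0 : forall N, tfamily R N l).
Variable m : imap (adjl l).

Definition mean_sum_map N (a : 'S_(nhalf m)) : R[i] :=
  netval (@fixed_weight R I l A0 m N) (@free_moment R d T P U I l m N) a
    (free_vertices m).

Lemma cexpectation_trace N : (0 < N)%N ->
  cexpectation (P N) (fun t => trace m (with_orthogonal (A0 N) (U t))) =
  N%:R ^- ncomponents m * mean_sum_map N (eperm m).
Proof.
move=> N0; rewrite -(cexpectation_compat hU A0 (eperm m) (N%:R ^- ncomponents m) N0).
by congr cexpectation; apply/funext => t; apply: trace_compat.
Qed.

Lemma cexpectation_switch f g N : (0 < N)%N ->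
  cexpectation (P N) (fun t => trace (switch f g) (with_orthogonal (A0 N) (U t))) =
  N%:R ^- ncomponents (switch f g) * mean_sum_map N (switch_perm (eperm m) f g).
Proof.
move=> N0; rewrite -(cexpectation_compat hU A0 _ (N%:R ^- ncomponents (switch f g)) N0).
by congr cexpectation; apply/funext => t; apply: (trace_compat (switch f g)).
Qed.

End Expectations.

Local Open Scope classical_set_scope.
Local Open Scope ring_scope.

Theorem proposition3 (R : realType)
  (d : nat -> measure_display) (T : forall N, measurableType (d N))
  (P : forall N, probability (T N) R) (U : forall N, T N -> 'M[R]_N)
  (hU : forall N, (0 < N)%N -> haar_orthogonal (P N) (U N))
  (I0 : finType) (l0 : I0 -> nat) (A0 : forall N, tfamily R N l0)
  (hconj : forall N, (0 < N)%N -> conj_stable (A0 N))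
  (A1 : forall n : imap l0, nboundary n = 0%N ->
     exists C : R, forall N, (0 < N)%N -> `|trace n (A0 N)| <= C%:C%C)
  (m : imap (adjl l0)) (hm : nboundary m = 0%N)
  (e : 'I_2) (u : vertex m) (hu : label u = None) :
  let A N t := with_orthogonal (A0 N) (U N t) in
  let S_plus v := [&& v != u, mconnect u v, label v == None &
    ncomponents (map_plus u v e) == (ncomponents m).+1] in
  let S_minus v := [&& v != u, mconnect u v, label v == None &
    ncomponents (map_minus u v e) == (ncomponents m).+1] in
  let D (N : nat) : R[i]^o :=
    cexpectation (P N) (fun t => trace m (A N t))
    - (\sum_(v | S_plus v) cexpectation (P N)
         (fun t => trace (map_plus u v e) (with_identity (A N t)))
       - \sum_(v | S_minus v) cexpectation (P N)
           (fun t => trace (map_minus u v e) (A N t))) in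
  (D =O_\oo (fun N : nat => N%:R^-1 : R[i]^o)) /\
  (forall N (t : T N) (v : vertex m), (0 < N)%N -> v != u -> label v = None ->
     let B := with_identity (A N t) in
     trace (map_plus u v e) B =
     vertex_trace (fun x : vertex (map_plus u v e) =>
       if same_vertex u x || same_vertex v x then mx_tensor _ 1%:M
       else label_tensor B x)).
Proof.
move=> A S_plus S_minus D; have aK := @epermK m; set a := eperm m in aK.
have af h : a h != h.
  by apply/negP => ah; have := card0_eq hm h; rewrite !inE ah.
have du := deg_free hu.
pose f := half_edge u e; pose g (v : vertex m) := half_edge v e.
split; last first.
  move=> N t v N0 vu hv B; have oU : orthogonal_mx (U N t) by case: (hU N N0).
  have dv := deg_free hv; have uv : u != v by rewrite eq_sym.
  have bf : f != g v.
    by apply/eqP => /(half_edge_inj du dv)[/eqP]; rewrite (negPf uv).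
  (* With or without the added identity loop, the half-edges [f] and [g v] are joined in [map_plus],
     so [trace_replace_identity] applies to the copies of [u] and [v]. *)
  rewrite /map_plus; case: eqP => [afg|/eqP afg].
    have half_un (x : vertex m) : deg x = 2%N ->
        half_edge (m := imap_union (some_label m) (identity_loop (adjl l0)))
          (union_vertex x) e = lshift 2 (half_edge x e).
      move=> dx; rewrite /half_edge bdry_union (nth_map (pcycle_least x)) //.
      by rewrite size_tuple -/(deg x) dx.
    have same_un (x : vertex m) (y : vertex (imap_union (some_label m) (identity_loop (adjl l0)))) :
        same_vertex x y = (y == union_vertex x).
      apply: same_vertexE; apply/eqP; rewrite bdry_union -[RHS]map_comp.
      by apply: eq_map => h.
    apply: (@trace_replace_identity R N _ _ (A0 N) (U N t) oU _
      (union_vertex u) (union_vertex v) e) => //.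
    - by rewrite (inj_eq (@union_vertex_inj _ _ m)).
    - by rewrite label_union hu.
    - by rewrite label_union hv.
    - by rewrite !half_un // -union_eperm afg.
    - by move=> x; rewrite !same_un.
  set sw := some_label (switch (half_edge u e) (half_edge v e)).
  have same_sw (x : vertex m) (y : vertex sw) : same_vertex x y = (y == x).
    exact: (same_vertexE (m' := sw) y (same_vertex_refl x)).
  apply: (@trace_replace_identity R N _ _ (A0 N) (U N t) oU sw u v e) => //.
  - by rewrite /= hu.
  - by rewrite /= hv.
  - by apply: switch_permL; rewrite // eq_sym.
  - by move=> x; rewrite !same_sw.
pose X N b := mean_sum_map P U A0 (m := m) N b.
(* In the degenerate case the factor [N] offsets the component added by the identity loop, so that
   division by [N ^ (k + 1)] is right in both cases. *)
pose pl v N := if a f == g v then X N a *+ N else X N (switch_perm a f (g v)).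
pose mi v N := X N (switch_perm a f (a (g v))).
pose VU := free_vertices m; pose k := ncomponents m.
have kE : k = ncomp (vperm m) a by [].
have uVU : u \in VU by rewrite inE hu.
have half_inj := @free_half_inj I0 l0 m.
have ga : good_perm (@half_edge m) VU VU a.
  by apply/good_permP; split=> // v ->.
have bnd b : good_perm (@half_edge m) VU VU b ->
    exists B N0, forall N, (N0 <= N)%N -> normc (X N b) <= B * N%:R ^+ ncomp (vperm m) b.
  move=> gb; apply: (@netval_bounded R _ _ (@half_edge m) VU _ _ (ncomp (vperm m)) half_inj).
  - by move=> N v e' i x; apply: fixed_weight_upd.
  - by move=> N K v e' i x; apply: free_moment_off.
  - by move=> N K e' i x y; apply: free_moment_SD.
  - by move=> N K v w e' i; apply: free_moment_orth.
  - exact: ncomp_le.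
  - by move=> b' f' g'; apply: ncomp_switch.
  - by move=> b' gb'; apply: (dead_bound P U A1 gb').
  - by [].
  - by [].
have SD N : (0 < N)%N -> X N a *+ N = X N a + \sum_(v in VU | v != u) (pl v N - mi v N).
  move=> N0; have card0 : (0 < #|'I_N|)%N by rewrite card_ord.
  apply/eqP; rewrite addrC -subr_eq; apply/eqP.
  have := @schwinger_dyson _ _ _ _ (@half_edge m) VU (@fixed_weight R I0 l0 A0 m N)
    (@free_moment R d T P U I0 l0 m N) card0 half_inj
    (fun v e i x => fixed_weight_upd A0 e i x (v := v))
    (fun K e i x y => free_moment_SD hU (K := K) e i x y N0) a VU u e aK af
    (fintype.subxx VU) uVU.
  by rewrite card_ord.
have memS v (b : bool) : [&& v != u, mconnect u v, label v == None & b] ->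
    (v \in VU) && (v != u).
  by case/and4P=> vu _ vN _; rewrite inE vN vu.
have scale N (x : R[i]) : (0 < N)%N ->
    N%:R ^- k.+1 * (x *+ N) = N%:R ^- k * x.
  move=> N0; rewrite -[x *+ N]mulr_natl exprS invfM mulrACA mulVf ?mul1r //.
  by rewrite pnatr_eq0 -lt0n.
have plE v N : (0 < N)%N -> S_plus v ->
    cexpectation (P N) (fun t => trace (map_plus u v e) (with_identity (A N t))) =
    N%:R ^- k.+1 * pl v N.
  move=> N0 /and4P[_ _ _]; rewrite /map_plus /pl -/f -/(g v) -/a.
  case: (a f =P g v) => _ => [_|/eqP kS].
    transitivity (cexpectation (P N) (fun t => trace m (A N t))).
      by congr cexpectation; apply/funext => t; apply: trace_union.
    by rewrite (cexpectation_trace hU A0 m N0) scale.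
  transitivity (cexpectation (P N) (fun t => trace (switch f (g v)) (A N t))).
    by congr cexpectation; apply/funext => t; apply: trace_some_label.
  by rewrite (cexpectation_switch hU A0 f (g v) N0) -/k -kS.
have miE v N : (0 < N)%N -> S_minus v ->
    cexpectation (P N) (fun t => trace (map_minus u v e) (A N t)) =
    N%:R ^- k.+1 * mi v N.
  move=> N0 /and4P[_ _ _ /eqP kS].
  by rewrite (cexpectation_switch hU A0 f (a (g v)) N0) -/k -kS.
(* Divided by [N ^ (k + 1)], the selected switches cancel the two sums of [D]; what remains is the
   copy of [X N a] not multiplied by [N] and the excluded switches. *)
have DE N : (0 < N)%N -> D N = N%:R ^- k.+1 *
    (X N a + \sum_(v | (v \in VU) && (v != u) && ~~ S_plus v) pl v N
           - \sum_(v | (v \in VU) && (v != u) && ~~ S_minus v) mi v N).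
  move=> N0; rewrite /D (cexpectation_trace hU A0 m N0).
  rewrite (eq_bigr _ (fun v => plE v N N0)) (eq_bigr _ (fun v => miE v N N0)).
  rewrite -!mulr_sumr -mulrBr.
  have -> : N%:R ^- ncomponents m * mean_sum_map P U A0 N (eperm m) =
      N%:R ^- k.+1 * (X N a *+ N) by rewrite scale.
  rewrite -mulrBr SD // sumrB; congr (_ * _).
  have -> : \sum_(v in VU | v != u) pl v N = \sum_(v | S_plus v) pl v N +
      \sum_(v | (v \in VU) && (v != u) && ~~ S_plus v) pl v N.
    rewrite (bigID S_plus) /=; congr (_ + _).
    by apply: eq_bigl => v; apply: andb_idl => /memS.
  have -> : \sum_(v in VU | v != u) mi v N = \sum_(v | S_minus v) mi v N +
      \sum_(v | (v \in VU) && (v != u) && ~~ S_minus v) mi v N.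
    rewrite (bigID S_minus) /=; congr (_ + _).
    by apply: eq_bigl => v; apply: andb_idl => /memS.
  by ring.
have conn (v : vertex m) : v \in VU -> mconnect u v = connect (adj (vperm m) a) f (g v).
  rewrite inE => /eqP/deg_free dv.
  by apply: mconnect_half; apply: half_edge_in.
(* A degenerate [v] is never excluded: the edge from [f] to [g v] connects it to [u], and the
   identity loop raises the number of components to [k + 1]. *)
have leP v : (v \in VU) && (v != u) && ~~ S_plus v ->
    (a f == g v) = false /\ (ncomp (vperm m) (switch_perm a f (g v)) <= k)%N.
  case/andP=> /andP[vU vu] nS; have [afg|afg] := eqVneq (a f) (g v).
    case/negP: nS; rewrite /S_plus vu conn // -afg connect1 ?adj_a //=.
    move: vU; rewrite inE => -> /=; rewrite /map_plus -/f -/(g v) -/a afg eqxx.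
    by rewrite ncomponents_union.
  split; first by apply: negbTE.
  apply: (ncomp_le_switch aK af); move: nS; rewrite /S_plus vu conn //=.
  move: vU; rewrite inE => -> /=; rewrite /map_plus -/f -/(g v) -/a (negPf afg).
  by rewrite negb_and.
have leM v : (v \in VU) && (v != u) && ~~ S_minus v ->
    (ncomp (vperm m) (switch_perm a f (a (g v))) <= k)%N.
  case/andP=> /andP[vU vu] nS; apply: (ncomp_le_switch aK af).
  move: nS; rewrite /S_minus vu conn //=; move: vU; rewrite inE => -> /=.
  (* The negative switch involves [a (g v)], which lies in the component of [g v]. *)
  rewrite negb_and -(same_connect_r (adj_sym _ _) (connect1 (adj_a _ _ _))).
  by [].
have bndk b : good_perm (@half_edge m) VU VU b -> (ncomp (vperm m) b <= k)%N ->
    exists B N0, forall N, (N0 <= N)%N -> normc (X N b) <= B * N%:R ^+ k.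
  move=> /bnd[B [N0 HB]] bk; exists `|B|, N0.+1 => N leN.
  have N1 : 1 <= N%:R :> R by rewrite ler1n (leq_ltn_trans _ leN).
  apply: le_trans (HB N (ltnW leN)) _.
  apply: (@le_trans _ _ (`|B| * N%:R ^+ ncomp (vperm m) b)).
    by rewrite ler_wpM2r ?ler_norm // exprn_ge0.
  exact: ler_wpM2l (normr_ge0 _) _ _ (ler_weXn2l N1 bk).
have pow0 (v : vertex m) N : 0 <= (N%:R : R) ^+ k by rewrite exprn_ge0.
have [B0 [N0 HB0]] := bndk a ga (leqnn _).
have [|B1 B1_ge0 [N1 HB1]] := uniform_bound (Q := fun v => (v \in VU) && (v != u) && ~~ S_plus v)
    (f := fun v N => normc (pl v N)) pow0.
  move=> v Qv; have [afg vk] := leP v Qv; rewrite /pl afg; apply: bndk vk.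
  by case/andP: Qv => /andP[vU _] _; apply: good_plus.
have [|B2 B2_ge0 [N2 HB2]] := uniform_bound (Q := fun v => (v \in VU) && (v != u) && ~~ S_minus v)
    (f := fun v N => normc (mi v N)) pow0.
  move=> v Qv; apply: bndk (leM v Qv).
  by case/andP: Qv => /andP[vU _] _; apply: good_minus.
have sumb (Q : pred (vertex m)) (F : vertex m -> R[i]) (B : R) : 0 <= B ->
    (forall v, Q v -> normc (F v) <= B) -> normc (\sum_(v | Q v) F v) <= #|{: vertex m}|%:R * B.
  move=> B_ge0 FB; apply: (@le_trans _ _ (\sum_(v | Q v) B)).
    apply: (big_ind2 (fun x y => normc x <= y)) => [|x1 x2 y1 y2 H1 H2|v /FB //].
      by rewrite ComplexField.Normc.normc0.
    by apply: le_trans (le_normcD _ _) _; apply: lerD.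
  by rewrite sumr_const -[leLHS]mulr_natl ler_wpM2r // ler_nat max_card.
(* The summand 1 makes the constant positive, as [eqO_exP] requires. *)
pose Bt := `|B0| + #|{: vertex m}|%:R * B1 + #|{: vertex m}|%:R * B2 + 1.
apply/eqO_exP; exists (Bt%:C)%C.
  rewrite ltcR ltr_wpDl // !addr_ge0 // mulr_ge0 //.
exists (N0 + N1 + N2).+1 => // N /= leN.
have Npos : (0 < N)%N by apply: leq_ltn_trans leN.
have [le0 le1 le2] : [/\ N0 <= N, N1 <= N & N2 <= N]%N.
  split; apply: leq_trans (ltnW leN); last exact: leq_addl.
    by rewrite -addnA leq_addr.
  by rewrite addnAC leq_addl.
have Ninv j : 0 <= (N%:R : R[i]) ^- j by rewrite invr_ge0 exprn_ge0.
rewrite DE // normrM (ger0_norm (Ninv k.+1)) (ger0_norm (Ninv 1%N)).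
have -> : (Bt%:C)%C * (N%:R : R[i])^-1 = N%:R ^- k.+1 * ((Bt * N%:R ^+ k)%:C)%C.
  rewrite rmorphM rmorphXn rmorph_nat exprS invfM mulrCA -[in RHS]mulrA mulVf ?mulr1 //.
  by rewrite expf_neq0 // pnatr_eq0 -lt0n.
apply: ler_wpM2l => //; rewrite normcE_real.
apply: le_trans (le_normcD _ _) _; rewrite normcN.
apply: (@le_trans _ _ ((`|B0| + #|{: vertex m}|%:R * B1 + #|{: vertex m}|%:R * B2) * N%:R ^+ k)).
  rewrite !mulrDl -!mulrA; apply: lerD.
    apply: le_trans (le_normcD _ _) _; apply: lerD.
      by apply: le_trans (HB0 N le0) _; rewrite ler_wpM2r ?ler_norm // exprn_ge0.
    by apply: sumb => [|v Qv]; [rewrite mulr_ge0 ?exprn_ge0 | apply: HB1].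
  by apply: sumb => [|v Qv]; [rewrite mulr_ge0 ?exprn_ge0 | apply: HB2].
by rewrite ler_wpM2r ?exprn_ge0 // lerDl.
Qed.
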